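(* Let $d\ge 1$, $\lambda>0$ and let $n\ge0$ be an integer. The elements of $\mathcal{V}_n^d(W_{-2})$ are orthogonal polynomials with respect to $\langle\cdot,\cdot\rangle_{-2}$, i.e. $\langle P,g\rangle_{-2}=0$ for every $P\in\mathcal{V}_n^d(W_{-2})$ and every polynomial $g$ of degree less than $n$. Moreover, they contain an orthonormal basis; in other words, as a linear space, $$\mathcal{V}_n^d(W_{-2})=\mathcal{H}_n^d\oplus(1-\|x\|^2)\mathcal{H}_{n-2}^d\oplus(1-\|x\|^2)^2\,\mathcal{V}_{n-4}^d(W_2),$$ where the sum is an orthogonal direct sum with respect to $\langle\cdot,\cdot\rangle_{-2}$.
   Context: Let $B^d=\{x\in\mathbb{R}^d:\|x\|\le 1\}$ and $S^{d-1}=\{x\in\mathbb{R}^d:\|x\|=1\}$, let $d\omega$ be the surface (Lebesgue) measure on $S^{d-1}$ and $\omega_d=\int_{S^{d-1}}d\omega=2\pi^{d/2}/\Gamma(d/2)$ (for $d=1$, $d\omega$ is counting measure on $\{-1,1\}$). All polynomials are real, in $d$ variables, and $\Delta$ is the Laplacian on $\mathbb{R}^d$. For a fixed $\lambda>0$ define the inner product on polynomials $$\langle f,g\rangle_{-2}=\frac{\lambda}{\omega_d}\int_{B^d}\Delta f(x)\,\Delta g(x)\,dx+\frac1{\omega_d}\int_{S^{d-1}}f(x)g(x)\,d\omega(x).$$ $\mathcal{H}_n^d$ is the space of harmonic homogeneous polynomials of degree $n$ ($\Delta Y=0$). $\mathcal{V}_n^d(W_2)$ is the space of orthogonal polynomials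 of degree $n$ with respect to the weight $W_2(x)=(1-\|x\|^2)^2$ on $B^d$: the polynomials $P$ of degree at most $n$ with $\int_{B^d}P(x)g(x)(1-\|x\|^2)^2dx=0$ for all polynomials $g$ of degree less than $n$. For $n<0$ both $\mathcal{H}_n^d$ and $\mathcal{V}_n^d(W_2)$ are empty (contribute nothing). For a function $g$ and a space $V$, $gV=\{gp:p\in V\}$. Define $$\mathcal{V}_n^d(W_{-2})=\mathcal{H}_n^d\cup(1-\|x\|^2)\mathcal{H}_{n-2}^d\cup(1-\|x\|^2)^2\,\mathcal{V}_{n-4}^d(W_2),$$ this union being identified with its linear span when it is regarded as a linear space. *)

(* Defs.v *)
From HB Require Import structures.
From mathcomp Require Import all_boot all_order all_algebra.
(* The notations of mpoly clash with those of MathComp-Analysis; hence the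
   prefix forms [mpoly d R] for {mpoly R[d]}, [meval v p] for p.@[v] and
   [p \is ishomog1 k mdeg] for p \is k.-homog. *)
From mathcomp Require mpoly.
Export -(notations) mpoly.
From mathcomp Require Import all_classical all_reals all_analysis.
From mathcomp Require Import measurable_realfun.
Export Order.TTheory GRing.Theory Num.Theory numFieldNormedType.Exports.

Set Implicit Arguments.
Unset Strict Implicit.
Unset Printing Implicit Defensive.

Local Open Scope classical_set_scope.
Local Open Scope ring_scope.

(* R^d with its Borel sigma-algebra; [measurableTypeR R] is R itself, carrying
   the Borel sigma-algebra. *)
Notation euclid R d := (d.-tuple (measurableTypeR R)).

Section lebesgue_succ.
Context {R : realType} (d : nat).
Variable m : {sigma_finite_measure set (euclid R d) -> \bar R}.

Definition euclid_cons (x : measurableTypeR R * euclid R d) : euclid R d.+1 :=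
  [tuple of x.1 :: x.2].

Lemma measurable_euclid_cons :
  measurable_fun [set: measurableTypeR R * euclid R d] euclid_cons.
Proof. exact: measurable_cons. Qed.

Definition lebesgue_succ : set (euclid R d.+1) -> \bar R :=
  pushforward (lebesgue_measure \x m)%E euclid_cons.

HB.instance Definition _ := Measure.copy lebesgue_succ
  (measure_function_pushforward__canonical__measure_function_Measure
     (@lebesgue_measure R \x m)%E measurable_euclid_cons).

Lemma sigma_finite_lebesgue_succ : sigma_finite setT lebesgue_succ.
Proof.
have /sigma_finiteP[F [FT ndF Foo]] := sigma_finiteT (@lebesgue_measure R).
have /sigma_finiteP[G [GT ndG Goo]] := sigma_finiteT m.
exists (fun n => [set x : euclid R d.+1 |
    F n (thead x) /\ G n [tuple of behead x]]).
  apply/esym/seteqP; split => // x _.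
  have [i _ Fi] : (\bigcup_i F i) (thead x) by rewrite -FT.
  have [j _ Gj] : (\bigcup_i G i) [tuple of behead x] by rewrite -GT.
  exists (maxn i j) => //; split.
  - by move: Fi; exact/subsetPset/ndF/leq_maxl.
  - by move: Gj; exact/subsetPset/ndG/leq_maxr.
move=> n; have [mF Fn] := Foo n; have [mG Gn] := Goo n; split.
  apply: measurableI; rewrite -[X in measurable X]setTI.
  - exact: measurable_tnth.
  - exact: measurable_behead.
rewrite /lebesgue_succ /pushforward (_ : _ @^-1` _ = F n `*` G n).
  by rewrite product_measure1E// lte_mul_pinfty// ge0_fin_numE.
apply/seteqP; split => -[a b] /=; rewrite theadE (_ : [tuple of _] = b) //;
exact/val_inj.
Qed.

HB.instance Definition _ :=
  Measure_isSigmaFinite.Build _ _ _ lebesgue_succ sigma_finite_lebesgue_succ.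

End lebesgue_succ.

(* d-dimensional Lebesgue measure, as an iterated product measure. *)
Fixpoint lebesgue_d {R : realType} (d : nat) :
    {sigma_finite_measure set (euclid R d) -> \bar R} :=
  if d is k.+1 return {sigma_finite_measure set (euclid R d) -> \bar R}
  then lebesgue_succ (lebesgue_d k)
  else \d_([tuple] : euclid R 0).

Section ball_sphere.
Context (R : realType) (d : nat).

Definition enorm (x : euclid R d) : R :=
  Num.sqrt (\sum_(i < d) tnth x i ^+ 2).

Definition unit_ball : set (euclid R d) := [set x | enorm x <= 1].

Definition unit_sphere : set (euclid R d) := [set x | enorm x = 1].

Lemma measurable_enorm : measurable_fun setT enorm.
Proof.
have mS : measurable_fun [set: euclid R d]
    (fun x : euclid R d => \sum_(i < d) tnth x i ^+ 2 : R).
  by apply: measurable_sum => i; apply: measurable_funX; exact: measurable_tnth.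
rewrite (_ : enorm = fun x => (\sum_(i < d) tnth x i ^+ 2) `^ 2^-1).
  exact: (measurableT_comp (measurable_powR (2^-1)) mS).
by apply/funext => x; rewrite powR12_sqrt// sumr_ge0// => i _; rewrite sqr_ge0.
Qed.

Lemma measurable_unit_ball : measurable unit_ball.
Proof.
rewrite (_ : unit_ball = setT `&` enorm @^-1` [set` `]-oo, 1]]).
  exact: measurable_enorm.
by rewrite setTI; apply/seteqP; split => x; rewrite /= in_itv.
Qed.

(* Radial projection onto the sphere; it fixes the origin, a null set for
   d >= 1. *)
Definition radial (x : euclid R d) : euclid R d :=
  [tuple tnth x i / enorm x | i < d].

Lemma measurable_radial : measurable_fun setT radial.
Proof.
apply/measurable_fun_tnthP => i.
rewrite (_ : _ \o _ = fun x => tnth x i * (enorm x) `^ (-1)).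
  apply: measurable_funM; first exact: measurable_tnth.
  exact: (measurableT_comp (measurable_powR (-1)) measurable_enorm).
by apply/funext => x /=; rewrite tnth_mktuple powR_inv1 ?sqrtr_ge0.
Qed.

Definition cone_measure : set (euclid R d) -> \bar R :=
  pushforward (mrestr (lebesgue_d d) measurable_unit_ball) radial.

HB.instance Definition _ := Measure.copy cone_measure
  (measure_function_pushforward__canonical__measure_function_Measure
     (mrestr (lebesgue_d d) measurable_unit_ball) measurable_radial).

(* The surface measure of the sphere, defined through polar coordinates:
   omega(A) = d * vol {x in B^d | x / |x| in A}.
   For d = 1 it is the counting measure on {-1, 1}. *)
Definition surface_measure : {measure set (euclid R d) -> \bar R} :=
  mscale (d%:R%:nng) cone_measure.

Definition sphere_area : R := \int[surface_measure]_(x in unit_sphere) 1.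

End ball_sphere.

Arguments unit_ball : clear implicits.
Arguments unit_sphere : clear implicits.
Arguments surface_measure : clear implicits.
Arguments sphere_area : clear implicits.

Section linear.
Context (R : pzRingType) (V : lmodType R).

(* In particular [lspan set0 = [set 0]]. *)
Definition lspan (A : set V) : set V :=
  [set v | exists (m : nat) (c : 'I_m -> R) (a : 'I_m -> V),
     (forall i, A (a i)) /\ v = \sum_(i < m) c i *: a i].

Definition orthonormal_family (ip : V -> V -> R) (m : nat) (b : 'I_m -> V) :=
  forall i j, ip (b i) (b j) = (i == j)%:R.

Definition orthogonal_sets (ip : V -> V -> R) (A B : set V) :=
  forall a b, A a -> B b -> ip a b = 0.

Definition orthogonal_direct_sum3 (ip : V -> V -> R) (S A B C : set V) :=
  [/\ S = [set v | exists a b c, [/\ A a, B b, C c & v = a + b + c]],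
      forall a b c, A a -> B b -> C c -> a + b + c = 0 ->
        [/\ a = 0, b = 0 & c = 0],
      orthogonal_sets ip A B, orthogonal_sets ip A C
    & orthogonal_sets ip B C].

End linear.

Section orthogonal_polynomials.
Context (R : realType) (d : nat).
Implicit Types (p f g : mpoly d R).

Definition peval p (x : euclid R d) : R := meval (tnth x) p.

Definition laplacian p : mpoly d R := \sum_(i < d) mderiv i (mderiv i p).

(* The polynomial 1 - |x|^2. *)
Definition one_sub_sqnorm : mpoly d R := 1 - \sum_(i < d) mpolyX R (mnm1 i) ^+ 2.

Definition sobolev_ip (lambda : R) f g : R :=
  lambda / sphere_area R d *
    (\int[lebesgue_d d]_(x in unit_ball R d)
       (peval (laplacian f) x * peval (laplacian g) x)) +
  (sphere_area R d)^-1 *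
    (\int[surface_measure R d]_(x in unit_sphere R d) (peval f x * peval g x)).

Definition W2_ip f g : R :=
  \int[lebesgue_d d]_(x in unit_ball R d)
    (peval f x * peval g x * (1 - enorm x ^+ 2) ^+ 2).

(* [msize p] is the total degree plus one, and [msize 0 = 0]. *)
Definition orthopoly (ip : mpoly d R -> mpoly d R -> R) (n : nat) :
    set (mpoly d R) :=
  [set p | (msize p <= n.+1)%N /\
           forall g, (msize g <= n)%N -> ip p g = 0].

Definition harmonic_homog (k : int) : set (mpoly d R) :=
  if k is Posz m
  then [set Y | Y \is ishomog1 m mdeg /\ laplacian Y = 0] else set0.

Definition orthopolyW2 (k : int) : set (mpoly d R) :=
  if k is Posz m then orthopoly W2_ip m else set0.

Definition piece0 (n : nat) : set (mpoly d R) := harmonic_homog n%:Z.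

Definition piece1 (n : nat) : set (mpoly d R) :=
  [set one_sub_sqnorm * Y | Y in harmonic_homog (n%:Z - 2)].

Definition piece2 (n : nat) : set (mpoly d R) :=
  [set one_sub_sqnorm ^+ 2 * Q | Q in orthopolyW2 (n%:Z - 4)].

(* V_n^d(W_{-2}) as a set; the linear space is its [lspan]. *)
Definition VWm2 (n : nat) : set (mpoly d R) :=
  piece0 n `|` piece1 n `|` piece2 n.

End orthogonal_polynomials.

Arguments piece0 : clear implicits.
Arguments piece1 : clear implicits.
Arguments piece2 : clear implicits.
Arguments VWm2 : clear implicits.

(* Main.v *)
Require Import Defs.
From HB Require Import structures.
From mathcomp Require Import all_boot all_order all_algebra.
From mathcomp Require Import all_classical all_reals all_analysis.
From mathcomp Require Import measurable_realfun.
From mathcomp Require Import ring lra zify.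

Set Implicit Arguments.
Unset Strict Implicit.
Unset Printing Implicit Defensive.

Local Open Scope classical_set_scope.
Local Open Scope ring_scope.

(** Write [w] for [1 - |x|^2], [IB] for the integral over the ball and [IS] for
the integral over the sphere.

Orthogonality. A harmonic homogeneous [Y] of degree [k] is orthogonal to every
polynomial of lower degree, both on the sphere and on the ball
([sphere_harmonic_lower], [ball_harmonic_lower]). For a harmonic [Y] the term
of the inner product with the Laplacians vanishes. For [w * Y] the boundary
term vanishes and [laplacian (w * Y)] is a multiple of [Y], so that the term
left is a ball integral of [Y] against a polynomial of lower degree. For
[w ^+ 2 * Q] both the values and the normal derivative vanish on the sphere, so
Green's second identity ([green_w2]) moves the Laplacian over and leaves the
[W_2]-integral of [Q] against a double Laplacian. The same three computations
give the mutual orthogonality of the pieces, since [w * Y] is biharmonic.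

Completeness. Every polynomial is [h + w * q] with [h] harmonic and the degree
of [q] smaller by two ([harmonic_decomposition]). Applied to [f], and again to
its quotient, this gives [f = h + w * h' + w ^+ 2 * q']. Modulo lower degree
[h] and [h'] can be replaced by their top homogeneous components, and [q'] by
its difference with its [W_2]-projection on lower degree; thus [f] agrees with
an element of the span of the pieces up to lower degree ([VWm2_top]). If [f] is
itself an orthogonal polynomial, the difference is orthogonal to itself, hence
zero, because the inner product is definite ([sobolev_definite]). The three
pieces being mutually orthogonal, a maximal orthonormal family in their union
spans it ([orthonormal_basis_setU3]).

Integration. All this is algebra over a few properties of [IB] and [IS],
collected in [green_pair]: positivity, the vanishing of [IS] on multiples of
[w], and the divergence theorem [IB (d_i p) = IS (x_i * p)]. Definiteness on
the ball is also obtained algebraically, from the positivity of the volume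
([weighted_ip_nondegenerate]). The divergence theorem comes from two facts.
The integral of [d_i (w * p)] over the ball is zero, by Fubini's theorem and
the fundamental theorem of calculus on chords ([integral_div_term]). For [p]
homogeneous of degree [k], [IS p = (d + k) * IB p] ([sphere_int_homog]): the
surface measure is defined by radial projection of the ball, the volume scales
by [r ^+ d], and on a thin shell below the sphere [p] is close to its radial
projection ([shell_estimate]). *)

(** * Spans and orthonormal bases *)

Section span.
Context {R : pzRingType} {V : lmodType R}.
Implicit Types (A B : set V) (u v : V).

Definition lin_subspace A :=
  [/\ A 0, forall u v, A u -> A v -> A (u + v) & forall c v, A v -> A (c *: v)].

Lemma lin_subspace_sum A (I : Type) (r : seq I) (Q : pred I) (F : I -> V) :
  lin_subspace A -> (forall i, Q i -> A (F i)) -> A (\sum_(i <- r | Q i) F i).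
Proof. by move=> [A0 AD _] AF; elim/big_ind : _. Qed.

Lemma lin_subspaceB A u v : lin_subspace A -> A u -> A v -> A (u - v).
Proof. by move=> [_ AD AZ] Au Av; rewrite -scaleN1r; apply/AD/AZ. Qed.

Lemma lspan_sub A B : lin_subspace B -> A `<=` B -> lspan A `<=` B.
Proof.
move=> sB AB _ [m [c [a [Aa ->]]]]; apply: lin_subspace_sum => // i _.
by case: sB => _ _; apply; exact: AB.
Qed.

Lemma sub_lspan A : A `<=` lspan A.
Proof.
move=> v Av; exists 1%N, (fun=> 1), (fun=> v); split=> //.
by rewrite big_ord1 scale1r.
Qed.

Lemma lin_subspace_lspan A : lin_subspace (lspan A).
Proof.
split.
- by exists 0%N, (fun=> 0), (fun=> 0); split; [case|rewrite big_ord0].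
- move=> _ _ [m [c [a [Aa ->]]]] [n [c' [a' [Aa' ->]]]].
  exists (m + n)%N, (fun i => match fintype.split i with inl i => c i | inr i => c' i end),
    (fun i => match fintype.split i with inl i => a i | inr i => a' i end); split.
    by move=> i; case: splitP => j _.
  rewrite big_split_ord; congr (_ + _); apply: eq_bigr => i _.
    by rewrite (unsplitK (inl i)).
  by rewrite (unsplitK (inr i)).
- move=> k _ [m [c [a [Aa ->]]]]; exists m, (fun i => k * c i), a; split=> //.
  by rewrite scaler_sumr; apply: eq_bigr => i _; rewrite scalerA.
Qed.

Lemma lspanS A B : A `<=` B -> lspan A `<=` lspan B.
Proof.
by move=> AB; apply: lspan_sub (lin_subspace_lspan _) _ => v /AB; exact: sub_lspan.
Qed.

Lemma lspan_range (m : nat) (b : 'I_m -> V) :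
  lspan (range b) = [set v | exists c : 'I_m -> R, v = \sum_i c i *: b i].
Proof.
apply/seteqP; split=> [|_ [c ->]]; last first.
  by exists m, c, b; split=> // i; exists i.
apply: lspan_sub => [|_ [i _ <-]].
  split.
  - by exists (fun=> 0); rewrite big1// => i _; rewrite scale0r.
  - move=> _ _ [c ->] [c' ->]; exists (fun i => c i + c' i).
    by rewrite -big_split; apply: eq_bigr => i _; rewrite scalerDl.
  - move=> k _ [c ->]; exists (fun i => k * c i).
    by rewrite scaler_sumr; apply: eq_bigr => i _; rewrite scalerA.
exists (fun j => (j == i)%:R).
rewrite (bigD1 i)//= eqxx scale1r big1 ?addr0// => j /negPf ->.
by rewrite scale0r.
Qed.

End span.

Section inner_product.
Context {R : realType} {V : lmodType R}.
Implicit Types (ip : V -> V -> R) (A S : set V) (u v : V).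

Definition semi_inner ip :=
  [/\ forall u v, ip u v = ip v u,
      forall a u u' v, ip (a *: u + u') v = a * ip u v + ip u' v
    & forall u, 0 <= ip u u].

Definition definite ip := forall u, ip u u = 0 -> u = 0.

Section semi.
Context {ip : V -> V -> R} (Sip : semi_inner ip).

Lemma ipC u v : ip u v = ip v u. Proof. by case: Sip. Qed.

Lemma ip0l v : ip 0 v = 0.
Proof.
case: Sip => _ L _; have := L 1 0 0 v; rewrite scaler0 add0r mul1r => /eqP.
by rewrite -subr_eq subrr => /eqP.
Qed.

Lemma ipDl u u' v : ip (u + u') v = ip u v + ip u' v.
Proof. by case: Sip => _ L _; have := L 1 u u' v; rewrite scale1r mul1r. Qed.

Lemma ipZl a u v : ip (a *: u) v = a * ip u v.
Proof. by case: Sip => _ L _; have := L a u 0 v; rewrite addr0 ip0l addr0. Qed.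

Lemma ipBl u u' v : ip (u - u') v = ip u v - ip u' v.
Proof. by rewrite ipDl -scaleN1r ipZl mulN1r. Qed.

Lemma ip0r v : ip v 0 = 0. Proof. by rewrite ipC ip0l. Qed.

Lemma ipDr u u' v : ip v (u + u') = ip v u + ip v u'.
Proof. by rewrite ipC ipDl !(ipC v). Qed.

Lemma ipZr a u v : ip v (a *: u) = a * ip v u.
Proof. by rewrite ipC ipZl ipC. Qed.

Lemma ipBr u u' v : ip v (u - u') = ip v u - ip v u'.
Proof. by rewrite ipC ipBl !(ipC v). Qed.

Lemma ip_suml (I : Type) (r : seq I) (F : I -> V) v :
  ip (\sum_(i <- r) F i) v = \sum_(i <- r) ip (F i) v.
Proof. exact: (big_morph (ip^~ v) (fun x y => ipDl x y v) (ip0l v)). Qed.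

(** The degenerate case of the Cauchy-Schwarz inequality. *)
Lemma semi_inner_null u v : ip u u = 0 -> ip u v = 0.
Proof.
move=> u0; apply/eqP; apply/negPn/negP => uv0.
(* This multiple of [u] is chosen to make the square equal to [-1]. *)
have : 0 <= ip ((- (ip v v + 1) / (2 * ip u v)) *: u + v)
             ((- (ip v v + 1) / (2 * ip u v)) *: u + v) by case: Sip.
rewrite ipDl !ipDr !ipZl !ipZr u0 (ipC v u) !mulr0 add0r.
set t := _ / _; have -> : t * ip u v + (t * ip u v + ip v v) = - 1.
  by rewrite /t; field.
by rewrite oppr_ge0 ler10.
Qed.

Lemma ip_orthonormal (m : nat) (b : 'I_m -> V) (c : 'I_m -> R) j :
  orthonormal_family ip b -> ip (\sum_i c i *: b i) (b j) = c j.
Proof.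
move=> ob; rewrite ip_suml (bigD1 j)//= ipZl ob eqxx mulr1 big1 ?addr0// => i ij.
by rewrite ipZl ob (negPf ij) mulr0.
Qed.

(** With more vectors than generators, the matrix of the coordinates has a
nonzero vector in its left kernel; the corresponding combination of the [b i]
is zero. *)
Lemma orthonormal_size (m N : nat) (b : 'I_m -> V) (e : 'I_N -> V) :
  orthonormal_family ip b -> (forall i, lspan (range e) (b i)) -> (m <= N)%N.
Proof.
move=> ob be; rewrite leqNgt; apply/negP => Nm.
have /choice[c cE] : forall i, exists c : 'I_N -> R, b i = \sum_j c j *: e j.
  by move=> i; move: (be i); rewrite lspan_range.
pose C : 'M[R]_(m, N) := \matrix_(i, j) c i j.
have /rowV0Pn[v /sub_kermxP vC0 v0] : kermx C != 0.
  by rewrite -mxrank_eq0 mxrank_ker -lt0n subn_gt0 (leq_ltn_trans (rank_leq_col C)).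
move/negP : v0; apply; apply/eqP/rowP => j; rewrite mxE.
rewrite -(ip_orthonormal (fun i => v ord0 i) j ob).
rewrite (_ : \sum_i _ = 0) ?ip0l//.
under eq_bigr do rewrite cE scaler_sumr.
rewrite exchange_big big1//= => k _.
under eq_bigr do rewrite scalerA.
rewrite -scaler_suml (_ : \sum_i _ = 0) ?scale0r//.
move/rowP : vC0 => /(_ k); rewrite !mxE => vC0; rewrite -[RHS]vC0.
by apply: eq_bigr => i _; rewrite mxE.
Qed.

End semi.

(** A maximal orthonormal family in [S] spans [S], since otherwise a normalized
residual would extend it. The set [S] is only asked to be closed under residuals,
so that it may be a union of mutually orthogonal subspaces. *)
Lemma orthonormal_basis ip S (N : nat) (e : 'I_N -> V) :
  semi_inner ip -> definite ip ->
  (forall c v, S v -> S (c *: v)) ->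
  (forall m (b : 'I_m -> V), (forall i, S (b i)) -> orthonormal_family ip b ->
    forall v, S v -> S (v - \sum_i ip v (b i) *: b i)) ->
  S `<=` lspan (range e) ->
  exists m (b : 'I_m -> V), [/\ forall i, S (b i), orthonormal_family ip b
    & lspan (range b) = lspan S].
Proof.
move=> Sip Dip SZ Sres Se.
pose Q k := `[< exists b : 'I_k -> V,
  (forall i, S (b i)) /\ orthonormal_family ip b >].
have Q0 : exists k, Q k.
  by exists 0%N; apply/asboolP; exists (fun=> 0); split; case.
have QN k : Q k -> (k <= N)%N.
  move=> /asboolP[b [Sb ob]]; apply: (orthonormal_size Sip ob) => i.
  exact/Se/Sb.
case: (ex_maxnP Q0 QN) => m /asboolP[b [Sb ob]] max_m.
exists m, b; split=> //; apply/seteqP; split.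
  by apply: lspanS => _ [i _ <-]; exact: Sb.
apply: lspan_sub (lin_subspace_lspan _) _ => v Sv; rewrite lspan_range.
exists (fun i => ip v (b i)); apply/eqP; rewrite -subr_eq0.
set r := v - _; apply/negPn/negP => r0.
have Sr : S r by exact: Sres.
have rr : 0 < ip r r.
  rewrite lt0r; apply/andP; split; last by case: Sip.
  by apply: contra r0 => /eqP/Dip ->.
have rb i : ip r (b i) = 0.
  by rewrite /r (ipBl Sip) (ip_orthonormal Sip _ _ ob) subrr.
pose b' (i : 'I_m.+1) :=
  if unlift ord0 i is Some j then b j else (Num.sqrt (ip r r))^-1 *: r.
suff : Q m.+1 by move/max_m; rewrite ltnn.
apply/asboolP; exists b'; split.
  by move=> i; rewrite /b'; case: unliftP => [j|] _; [exact: Sb|exact: SZ].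
move=> i j; rewrite /b'; case: (unliftP ord0 i) => [i' ->|->];
  case: (unliftP ord0 j) => [j' ->|->].
- by rewrite ob (inj_eq (@lift_inj _ _)).
- by rewrite (ipZr Sip) (ipC Sip) rb mulr0 eq_sym (negPf (neq_lift _ _)).
- by rewrite (ipZl Sip) rb mulr0 (negPf (neq_lift _ _)).
- rewrite (ipZl Sip) (ipZr Sip) eqxx mulrA -expr2 exprVn sqr_sqrtr ?ltW//.
  by rewrite mulVf// gt_eqF.
Qed.

Lemma orthogonal_projection ip A (N : nat) (e : 'I_N -> V) v :
  semi_inner ip -> definite ip -> lin_subspace A -> A `<=` lspan (range e) ->
  exists2 u, A u & forall u', A u' -> ip (v - u) u' = 0.
Proof.
move=> Sip Dip sA Ae; have [A0 AD AZ] := sA.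
have [|m [b [Ab ob bA]]] := orthonormal_basis Sip Dip AZ _ Ae.
  move=> m b Ab _ u Au; apply: lin_subspaceB => //.
  by apply: lin_subspace_sum => // i _; exact: AZ.
exists (\sum_i ip v (b i) *: b i).
  by apply: lin_subspace_sum => // i _; exact: AZ.
move=> u Au; have : lspan (range b) u by rewrite bA; exact: sub_lspan.
rewrite lspan_range => -[c ->]; rewrite (ipC Sip) (ip_suml Sip) big1// => i _.
by rewrite (ipZl Sip) (ipBr Sip) (ipC Sip _ (\sum_i _)) (ip_orthonormal Sip _ _ ob)
  (ipC Sip) subrr mulr0.
Qed.

End inner_product.

Section union_basis.
Context {R : realType} {V : lmodType R}.
Implicit Types (ip : V -> V -> R) (A B C : set V) (u v : V).

Lemma orthogonal_lspan ip A B : semi_inner ip ->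
  orthogonal_sets ip A B -> orthogonal_sets ip (lspan A) (lspan B).
Proof.
move=> Sip AB u v [m [c [a [Aa ->]]]] [n [c' [b [Bb ->]]]].
rewrite (ip_suml Sip) big1// => i _; rewrite (ipZl Sip) (ipC Sip) (ip_suml Sip).
by rewrite big1 ?mulr0// => j _; rewrite (ipZl Sip) (ipC Sip) AB ?mulr0.
Qed.

Lemma lspan_setU A B :
  lspan (A `|` B) = [set v | exists a b, [/\ lspan A a, lspan B b & v = a + b]].
Proof.
have [A0 AD AZ] := lin_subspace_lspan A; have [B0 BD BZ] := lin_subspace_lspan B.
apply/seteqP; split=> [|_ [a [b [Aa Bb ->]]]]; last first.
  have [_ D _] := lin_subspace_lspan (A `|` B).
  by apply: D; [apply: lspanS Aa|apply: lspanS Bb] => v; [left|right].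
apply: lspan_sub => [|v [Av|Bv]]; last 2 first.
- by exists v, 0; rewrite addr0; split=> //; exact: sub_lspan.
- by exists 0, v; rewrite add0r; split=> //; exact: sub_lspan.
split.
- by exists 0, 0; rewrite addr0.
- move=> _ _ [a [b [Aa Bb ->]]] [a' [b' [Aa' Bb' ->]]].
  by exists (a + a'), (b + b'); rewrite addrACA; split; [exact: AD|exact: BD|].
- move=> c _ [a [b [Aa Bb ->]]]; exists (c *: a), (c *: b).
  by rewrite scalerDr; split; [exact: AZ|exact: BZ|].
Qed.

(** Unlike a subspace, such a set may be empty, as are the pieces whose index is
negative. *)
Definition linear_set A := forall c u v, A u -> A v -> A (c *: u + v).

Lemma linear_set_residual ip A (m : nat) (b : 'I_m -> V) v : linear_set A ->
  A v -> (forall i, A (b i) \/ ip v (b i) = 0) ->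
  A (v - \sum_i ip v (b i) *: b i).
Proof.
move=> lA Av Ab; rewrite -sumrN; apply: (big_rec (fun x => A (v + x))) => [|i x _ Ax].
  by rewrite addr0.
rewrite addrCA -scaleNr; case: (Ab i) => [|->]; first by move/lA; apply.
by rewrite oppr0 scale0r add0r.
Qed.

Lemma linear_setZ A c v : linear_set A -> A v -> A (c *: v).
Proof.
by move=> lA Av; have := lA (c - 1) v v Av Av; rewrite scalerBl scale1r subrK.
Qed.

Lemma orthonormal_basis_setU3 ip A B C (N : nat) (e : 'I_N -> V) :
  semi_inner ip -> definite ip ->
  linear_set A -> linear_set B -> linear_set C ->
  orthogonal_sets ip A B -> orthogonal_sets ip A C -> orthogonal_sets ip B C ->
  A `|` B `|` C `<=` lspan (range e) ->
  exists m (b : 'I_m -> V), [/\ forall i, (A `|` B `|` C) (b i),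
    orthonormal_family ip b & lspan (range b) = lspan (A `|` B `|` C)].
Proof.
move=> Sip Dip lA lB lC AB AC BC; apply: orthonormal_basis => //.
  by move=> c v [[]|] Av; [left; left|left; right|right]; exact: linear_setZ.
move=> m b Sb _ v [[Av|Bv]|Cv].
- left; left; apply: (linear_set_residual lA Av) => i.
  by case: (Sb i) => [[]|] bi; [left|right; exact: AB|right; exact: AC].
- left; right; apply: (linear_set_residual lB Bv) => i.
  case: (Sb i) => [[]|] bi; [right|by left|right; exact: BC].
  by rewrite (ipC Sip); exact: AB.
- right; apply: (linear_set_residual lC Cv) => i.
  by case: (Sb i) => [[]|] bi; [right|right|left => //]; rewrite (ipC Sip);
    [exact: AC|exact: BC].
Qed.

Lemma orthogonal_direct_sum3_lspan ip A B C :
  semi_inner ip -> definite ip ->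
  orthogonal_sets ip A B -> orthogonal_sets ip A C -> orthogonal_sets ip B C ->
  orthogonal_direct_sum3 ip (lspan (A `|` B `|` C)) (lspan A) (lspan B) (lspan C).
Proof.
move=> Sip Dip /(orthogonal_lspan Sip) AB /(orthogonal_lspan Sip) AC
  /(orthogonal_lspan Sip) BC.
split=> // [|a b c Aa Bb Cc abc].
  rewrite !lspan_setU; apply/seteqP; split=> v /=.
    move=> [_ [c [[a [b [Aa Bb ->]]] Cc ->]]].
    by exists a, b, c.
  by move=> [a [b [c [Aa Bb Cc ->]]]]; exists (a + b), c; split=> //; exists a, b.
have a0 : a = 0.
  by apply: Dip; rewrite -[RHS](ip0r Sip a) -abc !(ipDr Sip) (AB a b)// (AC a c)// !addr0.
have b0 : b = 0.
  apply: Dip; rewrite -[RHS](ip0r Sip b) -abc a0 add0r (ipDr Sip).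
  by rewrite (BC b c)// addr0.
by split=> //; rewrite -abc a0 b0 !add0r.
Qed.

End union_basis.


(** * Differential calculus of polynomials *)

Section polynomial_calculus.
Context {R : realType} {d : nat}.
Local Notation P := (mpoly d R).
Local Notation X i := (mpolyX R (mnm1 i) : P).
Local Notation D := mderiv.
Local Notation w := (one_sub_sqnorm R d).
Local Notation homog k := (ishomog1 k mdeg).
Implicit Types (p q f g : P) (i j : 'I_d) (k n : nat).

Definition sqnorm : P := \sum_(i < d) X i ^+ 2.

Definition euler p : P := \sum_i X i * D i p.

Definition grad_dot p q : P := \sum_i D i p * D i q.

Lemma mderivXU i j : D i (X j) = (i == j)%:R.
Proof.
rewrite mderivX mnm1E eq_sym; case: eqP => [->|_]; last by rewrite scale0r.
rewrite scale1r -mpolyX0; congr mpolyX; apply/mnmP => k.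
by rewrite mnmBE mnm0E subnn.
Qed.

Lemma mderiv1 i : D i (1 : P) = 0.
Proof. by rewrite -mpolyC1 mderivC. Qed.

Lemma one_sub_sqnormE : w = 1 - sqnorm. Proof. by []. Qed.

Lemma mderiv_sqnorm i : D i sqnorm = X i *+ 2.
Proof.
rewrite /sqnorm raddf_sum (bigD1 i)//= big1 ?addr0 => [|j ji].
  by rewrite expr2 mderivM mderivXU eqxx mulr1 mul1r mulr2n.
by rewrite expr2 mderivM mderivXU eq_sym (negPf ji) mul0r mulr0 addr0.
Qed.

Lemma mderiv_w i : D i w = - (X i *+ 2).
Proof. by rewrite one_sub_sqnormE mderivB mderiv1 mderiv_sqnorm sub0r. Qed.

Lemma mderiv_exp i p k : D i (p ^+ k.+1) = (D i p * p ^+ k) *+ k.+1.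
Proof.
elim: k => [|k IH]; first by rewrite expr0 mulr1 mulr1n.
by rewrite exprS mderivM IH mulrnAr mulrCA -exprS -mulrS.
Qed.

Lemma eulerD : {morph euler : p q / p + q}.
Proof.
move=> p q; rewrite /euler -big_split/=; apply: eq_bigr => i _.
by rewrite mderivD mulrDr.
Qed.

Lemma euler0 : euler 0 = 0.
Proof. by rewrite /euler big1// => i _; rewrite raddf0 mulr0. Qed.

Lemma eulerZ c p : euler (c *: p) = c *: euler p.
Proof.
rewrite /euler scaler_sumr; apply: eq_bigr => i _.
by rewrite mderivZ scalerAr.
Qed.

Lemma eulerM p q : euler (p * q) = euler p * q + p * euler q.
Proof.
rewrite /euler mulr_suml mulr_sumr -big_split/=; apply: eq_bigr => i _.
by rewrite mderivM; ring.
Qed.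

Lemma mulX_mderiv i (m : multinom d) :
  X i * D i (mpolyX R m) = (m i)%:R *: mpolyX R m.
Proof.
rewrite mderivX -scalerAr; have [->|mi0] := eqVneq (m i) 0%N; first by rewrite !scale0r.
congr (_ *: _); rewrite -mpolyXD addmC submK//; apply/mnm_lepP => j.
by rewrite mnm1E; case: eqP => // <-; rewrite lt0n.
Qed.

Lemma euler_mpolyX (m : multinom d) : euler (mpolyX R m) = mpolyX R m *+ mdeg m.
Proof.
rewrite /euler (eq_bigr (fun i => (m i)%:R *: mpolyX R m)); last first.
  by move=> i _; exact: mulX_mderiv.
by rewrite -scaler_suml -natr_sum scaler_nat mdegE.
Qed.

Lemma euler_homog k p : p \is homog k -> euler p = p *+ k.
Proof.
move=> /dhomogP hp; rewrite [in LHS](mpolyE p) [in RHS](mpolyE p).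
rewrite (big_morph _ eulerD euler0) -sumrMnl; apply: eq_big_seq => m mp.
rewrite eulerZ scalerMnr; congr (_ *: _).
by rewrite euler_mpolyX (hp _ mp : mdeg m = k).
Qed.

Lemma laplacianD : {morph @laplacian R d : p q / p + q}.
Proof.
move=> p q; rewrite /laplacian -big_split/=; apply: eq_bigr => i _.
by rewrite !mderivD.
Qed.

Lemma laplacianZ c p : laplacian (c *: p) = c *: laplacian p.
Proof.
rewrite /laplacian scaler_sumr; apply: eq_bigr => i _.
by rewrite !mderivZ.
Qed.

Lemma laplacianB p q : laplacian (p - q) = laplacian p - laplacian q.
Proof. by rewrite laplacianD -scaleN1r laplacianZ scaleN1r. Qed.

Lemma laplacianM p q :
  laplacian (p * q) = laplacian p * q + grad_dot p q *+ 2 + p * laplacian q.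
Proof.
rewrite /laplacian /grad_dot mulr_suml mulr_sumr -sumrMnl -!big_split/=.
by apply: eq_bigr => i _; rewrite !(mderivM, mderivD) mulr2n; ring.
Qed.

Lemma grad_dot_w p : grad_dot w p = - (euler p *+ 2).
Proof.
rewrite /grad_dot /euler -sumrMnl -sumrN; apply: eq_bigr => i _.
by rewrite mderiv_w mulNr mulrnAl.
Qed.

Lemma euler_w : euler w = (w - 1) *+ 2.
Proof.
have -> : w - 1 = - sqnorm by rewrite one_sub_sqnormE addrC addKr.
rewrite /euler mulNrn /sqnorm -sumrMnl -sumrN; apply: eq_bigr => i _.
by rewrite mderiv_w mulrN mulrnAr expr2.
Qed.

Lemma laplacian_w : laplacian w = - (2 * d)%:R.
Proof.
rewrite /laplacian (eq_bigr (fun=> - 2%:R)) => [|i _]; last first.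
  by rewrite mderiv_w mderivN mderivMn mderivXU eqxx.
by rewrite sumr_const card_ord natrM mulNrn mulr_natr.
Qed.

(** By Euler's identity a harmonic form is an eigenvector of
[p |-> laplacian (w * p)]; in particular [w * p] is biharmonic. *)
Lemma laplacian_w_harmonic k p : p \is homog k -> laplacian p = 0 ->
  laplacian (w * p) = - (p *+ (2 * d + 4 * k)).
Proof.
move=> hp Lp; rewrite laplacianM laplacian_w grad_dot_w Lp mulr0 addr0.
rewrite (euler_homog hp) mulNr mulr_natl mulNrn -opprD -!mulrnA -mulrnDr.
by congr (- (_ *+ _)); lia.
Qed.

Lemma msize_leP n p :
  (msize p <= n)%N <-> (forall m : multinom d, (n <= mdeg m)%N -> mcoeff m p = 0).
Proof.
split=> [pn m nm|h].
  by apply: memN_msupp_eq0; apply: msize_mdeg_ge; exact: leq_trans nm.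
rewrite msizeE; apply/bigmax_leqP_seq => m mp _.
by rewrite ltnNge; apply: contraL mp => /h/eqP; rewrite mcoeff_eq0.
Qed.

Lemma lin_subspace_msize n : lin_subspace [set p : P | (msize p <= n)%N].
Proof.
split=> /= [|p q /msize_leP hp /msize_leP hq|c p /msize_leP hp]; apply/msize_leP => m nm.
- by rewrite mcoeff0.
- by rewrite mcoeffD hp// hq// addr0.
- by rewrite mcoeffZ hp// mulr0.
Qed.

Lemma msize_sum_le (I : Type) (r : seq I) (Q : pred I) (F : I -> P) n :
  (forall t, Q t -> (msize (F t) <= n)%N) ->
  (msize (\sum_(i <- r | Q i) F i) <= n)%N.
Proof. exact: (lin_subspace_sum _ (lin_subspace_msize n)). Qed.

Lemma msizeB_le p q n : (msize p <= n)%N -> (msize q <= n)%N ->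
  (msize (p - q) <= n)%N.
Proof. exact: (lin_subspaceB (lin_subspace_msize n)). Qed.

Lemma msize_mderiv i p : (msize (D i p) <= (msize p).-1)%N.
Proof.
apply/msize_leP => m nm; rewrite mcoeff_deriv.
have h : (msize p <= mdeg (mnm_add m (mnm1 i)))%N by rewrite mdegD mdeg1; lia.
by rewrite ((msize_leP _ _).1 (leqnn _) _ h) mul0rn.
Qed.

Lemma msize_laplacian p : (msize (laplacian p) <= msize p - 2)%N.
Proof.
apply: msize_sum_le => i _.
have := msize_mderiv i (D i p); have := msize_mderiv i p; lia.
Qed.

Lemma msize_mul p q n n' : (msize p <= n.+1)%N -> (msize q <= n')%N ->
  (msize (p * q) <= n + n')%N.
Proof.
move=> pn qn; have [->|p0] := eqVneq p 0; first by rewrite mul0r msize0.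
have [->|q0] := eqVneq q 0; first by rewrite mulr0 msize0.
by rewrite (msizeM p0 q0) -subn1 leq_subLR add1n -addSn leq_add.
Qed.

Lemma homog_msize_le k p : p \is homog k -> (msize p <= k.+1)%N.
Proof.
move=> hp; apply/msize_leP => m km; apply: dhomog_nemf_coeff hp _.
by rewrite neq_ltn km orbT.
Qed.

Lemma msize_sqnorm : (msize sqnorm <= 3)%N.
Proof.
apply: homog_msize_le; rewrite /sqnorm; apply: rpred_sum => i _.
by rewrite mpolyXn dhomogX -[Y in Y == _]/(mdeg _) mdegMn mdeg1.
Qed.

Lemma msize_w : (msize w <= 3)%N.
Proof.
by apply: msizeB_le msize_sqnorm; rewrite msize1.
Qed.

Lemma msize_w_mul p n : (msize p <= n)%N -> (msize (w * p) <= n.+2)%N.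
Proof. by move=> pn; have := msize_mul msize_w pn. Qed.

Lemma homog_mderiv k i p : p \is homog k -> D i p \is homog k.-1.
Proof.
move=> hp; apply/dhomogP => m; rewrite mcoeff_msupp mcoeff_deriv.
have [<-|mk] := eqVneq (mdeg m).+1 k; first by [].
by rewrite (dhomog_nemf_coeff hp) ?mul0rn ?eqxx//= mdegD mdeg1 addn1.
Qed.

Lemma msize_sub_pihomog n p : (msize p <= n.+1)%N ->
  (msize (p - pihomog mdeg n p) <= n)%N.
Proof.
move=> pn; rewrite {1}(pihomog_partitionE pn) big_ord_recr/= addrK.
apply: msize_sum_le => i _.
by apply: leq_trans (homog_msize_le (pihomogP _ _ _)) _.
Qed.

(** A form of degree [k] is zero modulo lower degree only if it is zero. *)
Lemma homog_msize_eq0 k p : p \is homog k -> (msize p <= k)%N -> p = 0.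
Proof.
move=> hp pk; apply/mpolyP => m; rewrite mcoeff0.
have [mk|mk] := eqVneq (mdeg m) k; last exact: dhomog_nemf_coeff hp mk.
by have /msize_leP := pk; apply; rewrite mk.
Qed.

Lemma homog_laplacian k p : p \is homog k -> laplacian p \is homog (k - 2).
Proof.
move=> hp; rewrite /laplacian; apply: rpred_sum => i _.
by have := homog_mderiv i (homog_mderiv i hp); rewrite -!subn1 -subnDA.
Qed.

(** The Laplacian sends the component of degree [n] to a form of degree [n - 2] and
the rest to lower degree, so that the two images cannot cancel. *)
Lemma harmonic_pihomog n p : (msize p <= n.+1)%N -> laplacian p = 0 ->
  laplacian (pihomog mdeg n p) = 0.
Proof.
move=> pn Lp; have hom := homog_laplacian (pihomogP mdeg n p).
apply: (homog_msize_eq0 hom); have low := msize_sub_pihomog pn.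
have -> : laplacian (pihomog mdeg n p) = - laplacian (p - pihomog mdeg n p).
  by rewrite laplacianB Lp sub0r opprK.
rewrite msizeN; apply: leq_trans (msize_laplacian _) _.
by apply: leq_sub2r.
Qed.

Lemma mderiv_eq0_const p : (forall i, D i p = 0) -> p = mpolyC d (mcoeff (@mnm0 d) p).
Proof.
move=> Dp; apply/mpolyP => m; rewrite mcoeffC.
have [->|m0] := eqVneq m (@mnm0 d); first by rewrite mulr1.
rewrite mulr0; have [i mi] : exists i, m i != 0%N.
  apply/existsP; apply: contraNT m0 => /existsPn h; apply/eqP/mnmP => i.
  by rewrite mnm0E; apply/eqP/negPn/h.
have := mcoeff_deriv i (mnm_sub m (mnm1 i)) p.
rewrite Dp mcoeff0 submK; last first.
  by apply/mnm_lepP => j; rewrite mnm1E; case: eqP => // <-; rewrite lt0n.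
by move/esym/eqP; rewrite mulrn_eq0/= => /eqP.
Qed.

End polynomial_calculus.

(** * Integration over the ball and the sphere as an abstract pair of functionals *)

Section green_pairs.
Context {R : realType} {d : nat}.
Local Notation P := (mpoly d R).
Local Notation X i := (mpolyX R (mnm1 i) : P).
Local Notation D := mderiv.
Local Notation w := (one_sub_sqnorm R d).
Local Notation homog k := (ishomog1 k mdeg).
Implicit Types (p q f g h : P) (i j : 'I_d) (k n : nat).

(** The properties of the integrals over the ball and the sphere on which the
algebraic part rests. *)
Record green_pair (IB IS : {scalar P}) : Prop := GreenPair {
  ball_weight_ge0 : forall k p, 0 <= IB (w ^+ k * (p * p));
  sphere_ge0 : forall p, 0 <= IS (p * p);
  ball_gt0 : 0 < IB 1;
  divergence : forall i p, IB (D i p) = IS (X i * p);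
  sphere_w : forall p, IS (w * p) = 0 }.

Context {IB IS : {scalar P}} (G : green_pair IB IS).

Let sphere_w2 p q : IS (p * (w * q)) = 0.
Proof. by rewrite mulrCA (sphere_w G). Qed.

Lemma sphere_sqnorm p : IS (sqnorm * p) = IS p.
Proof.
have -> : sqnorm = 1 - w by rewrite one_sub_sqnormE opprB addrC subrK.
by rewrite mulrBl mul1r raddfB/= (sphere_w G) subr0.
Qed.

Lemma divergence_sum (F : 'I_d -> P) :
  IB (\sum_i D i (F i)) = IS (\sum_i X i * F i).
Proof. by rewrite !raddf_sum/=; apply: eq_bigr => i _; exact: divergence. Qed.

Lemma sphere_euler p : IS p = IB (p *+ d + euler p).
Proof.
rewrite -[LHS]sphere_sqnorm /sqnorm mulr_suml.
under eq_bigr do rewrite expr2 -mulrA.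
rewrite -divergence_sum; congr (IB _).
under eq_bigr do rewrite mderivM mderivXU eqxx mul1r.
by rewrite big_split/= sumr_const card_ord.
Qed.

(** Integration in polar coordinates, here a consequence of the divergence theorem
for the field [p * x]. *)
Lemma sphere_homog k p : p \is homog k -> IS p = (d + k)%:R * IB p.
Proof.
move=> hp; rewrite sphere_euler (euler_homog hp) -mulrnDr raddfMn/=.
by rewrite mulr_natl.
Qed.

Lemma grad_dotC f g : grad_dot f g = grad_dot g f.
Proof. by apply: eq_bigr => i _; rewrite mulrC. Qed.

Lemma green_first f g :
  IB (grad_dot f g) + IB (f * laplacian g) = IS (f * euler g).
Proof.
rewrite -raddfD /= /euler mulr_sumr.
under [in RHS]eq_bigr do rewrite mulrCA.
rewrite -divergence_sum; congr (IB _).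
rewrite /laplacian mulr_sumr -big_split/=.
by apply: eq_bigr => i _; rewrite mderivM.
Qed.

Lemma green_w f g : IB (grad_dot (w * f) g) = - IB (w * (f * laplacian g)).
Proof.
have := green_first (w * f) g; rewrite -!mulrA (sphere_w G) => /eqP.
by rewrite addr_eq0 => /eqP.
Qed.

(** Green's second identity without boundary terms: [w ^+ 2 * q] and its normal
derivative vanish on the sphere. *)
Lemma green_w2 q h :
  IB (laplacian (w ^+ 2 * q) * h) = IB (w ^+ 2 * (q * laplacian h)).
Proof.
have := green_first h (w ^+ 2 * q); have := green_w (w * q) h.
rewrite grad_dotC !mulrA -expr2 => ->.
have -> : euler (w ^+ 2 * q) = w * (euler w * q + euler (w * q)).
  by rewrite expr2 -mulrA eulerM; ring.
rewrite sphere_w2 => /eqP; rewrite addrC subr_eq0 => /eqP <-.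
by rewrite mulrC.
Qed.

Definition weighted_ip k f g := IB (w ^+ k * f * g).

Definition sobolev_form (a b : R) f g :=
  a * IB (laplacian f * laplacian g) + b * IS (f * g).

Definition dirichlet_form f g := IB (grad_dot f g) + IS (f * g).

Let lin_ball a f f' g : IB ((a *: f + f') * g) = a * IB (f * g) + IB (f' * g).
Proof. by rewrite mulrDl -scalerAl linearP. Qed.

Let lin_sphere a f f' g : IS ((a *: f + f') * g) = a * IS (f * g) + IS (f' * g).
Proof. by rewrite mulrDl -scalerAl linearP. Qed.

Lemma weighted_ip_semi k : semi_inner (weighted_ip k).
Proof.
split=> [f g|a f f' g|f]; rewrite /weighted_ip.
- by rewrite mulrAC.
- by rewrite mulrDr -scalerAr lin_ball.
- by rewrite -mulrA (ball_weight_ge0 G).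
Qed.

Lemma ball_ge0 f : 0 <= IB (f * f).
Proof. by have := ball_weight_ge0 G 0 f; rewrite expr0 mul1r. Qed.

Lemma sphere_semi : semi_inner (fun f g => IS (f * g)).
Proof.
split=> [f g|a f f' g|f]; [by rewrite mulrC|exact: lin_sphere|].
exact: (sphere_ge0 G).
Qed.

Lemma euler_exp p k : euler (p ^+ k.+1) = (euler p * p ^+ k) *+ k.+1.
Proof.
rewrite /euler mulr_suml -sumrMnl; apply: eq_bigr => i _.
by rewrite mderiv_exp mulrnAr mulrA.
Qed.

(** The divergence of the field [w ^+ k.+1 * x], which vanishes on the sphere. *)
Lemma ball_w_rec k :
  (d + 2 * k.+1)%:R * IB (w ^+ k.+1) = (2 * k.+1)%:R * IB (w ^+ k).
Proof.
have : IS (w ^+ k.+1) = 0 by rewrite exprS (sphere_w G).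
rewrite sphere_euler euler_exp euler_w (mulrnAl (w - 1)) -mulrnA mulrBl mul1r -exprS.
rewrite raddfD raddfMn raddfMn raddfB /= -[IB _ *+ d]mulr_natl.
rewrite -[(IB _ - IB _) *+ _]mulr_natl natrD mulrBr addrA => /eqP.
by rewrite subr_eq0 -mulrDl => /eqP.
Qed.

Lemma ball_w_gt0 k : 0 < IB (w ^+ k).
Proof.
elim: k => [|k IH]; first by rewrite expr0; case: G.
rewrite -(pmulr_rgt0 _ (_ : 0 < (d + 2 * k.+1)%:R)) ?ltr0n//.
  by rewrite ball_w_rec mulr_gt0// ltr0n.
by rewrite addn_gt0 muln_gt0 orbT.
Qed.

(** The ideal of the polynomials that are orthogonal to everything for one of
the weights is closed under differentiation: integrating by parts costs one
more factor [w]. A nonzero element could be differentiated down to a nonzero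
constant, which [ball_w_gt0] excludes. *)
Lemma weighted_ip_nondegenerate p k :
  (forall q, weighted_ip k p q = 0) -> p = 0.
Proof.
move: (leqnn (msize p)); move: {2}(msize p) => n.
elim: n p k => [|n IH] p k pn p0.
  by apply/eqP; rewrite -msize_poly_eq0 -leqn0.
have Dp i : D i p = 0.
  apply: (IH _ k.+1) => [|q].
    by apply: leq_trans (msize_mderiv i p) _; lia.
  have := divergence G i (w * (w ^+ k * (p * q))).
  rewrite sphere_w2 mulrA -exprS mderivM mderiv_exp mderivM mderiv_w.
  rewrite /weighted_ip in p0 *.
  have -> : (- (X i *+ 2) * w ^+ k) *+ k.+1 * (p * q) +
      w ^+ k.+1 * (D i p * q + p * D i q) =
    w ^+ k.+1 * D i p * q +
    w ^+ k * p * (w * D i q - (X i *+ 2 * q) *+ k.+1).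
    by rewrite exprS; ring.
  by rewrite raddfD/= p0 addr0.
have pE := mderiv_eq0_const Dp; have := p0 1.
rewrite /weighted_ip mulr1 pE mulrC mul_mpolyC linearZ/= => /eqP.
by rewrite mulf_eq0 (gt_eqF (ball_w_gt0 k)) orbF => /eqP ->; rewrite mpolyC0.
Qed.

Lemma weighted_ip_definite k : definite (weighted_ip k).
Proof.
move=> f f0; apply: (@weighted_ip_nondegenerate _ k) => q.
exact: (semi_inner_null (weighted_ip_semi k)).
Qed.

Lemma ball_definite f : IB (f * f) = 0 -> f = 0.
Proof.
move=> f0; apply: (@weighted_ip_definite 0).
by rewrite /weighted_ip expr0 mul1r.
Qed.

(** Without energy [f] is a constant, and the sphere has positive area. *)
Lemma energy_sphere_definite f :
  IB (grad_dot f f) = 0 -> IS (f * f) = 0 -> (0 < d)%N -> f = 0.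
Proof.
move=> Bf Sf d0; have Df i : D i f = 0.
  apply: ball_definite; move/eqP: Bf; rewrite raddf_sum/= psumr_eq0.
    by move=> /allP/(_ i); rewrite mem_index_enum => /(_ isT)/eqP.
  by move=> j _; exact: ball_ge0.
have fE := mderiv_eq0_const Df; move: Sf; rewrite fE -mpolyCM.
rewrite -[mpolyC _ _]mulr1 mul_mpolyC linearZ/= => /eqP.
have -> : IS 1 = d%:R * IB 1 by rewrite (sphere_homog (dhomog1 _ _)) ?addn0.
rewrite !mulf_eq0 orbb pnatr_eq0 (gtn_eqF d0) (gt_eqF (ball_gt0 G)) !orbF.
by move=> /eqP ->; rewrite mpolyC0.
Qed.

Lemma dirichlet_semi : semi_inner dirichlet_form.
Proof.
rewrite /dirichlet_form; split=> [f g|a f f' g|f].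
- by rewrite grad_dotC (mulrC f).
- have -> : grad_dot (a *: f + f') g = a *: grad_dot f g + grad_dot f' g.
    rewrite /grad_dot scaler_sumr -big_split/=; apply: eq_bigr => i _.
    by rewrite linearP mulrDl scalerAl.
  by rewrite lin_sphere linearP/=; ring.
- apply: addr_ge0 (sphere_ge0 G _); rewrite raddf_sum sumr_ge0// => i _.
  exact: ball_ge0.
Qed.

Lemma dirichlet_definite : (0 < d)%N -> definite dirichlet_form.
Proof.
move=> d0 f /eqP; rewrite /dirichlet_form paddr_eq0 ?(sphere_ge0 G)//.
  by move=> /andP[/eqP ? /eqP ?]; exact: energy_sphere_definite.
by rewrite raddf_sum sumr_ge0// => i _; exact: ball_ge0.
Qed.

Lemma sobolev_semi (a b : R) : 0 <= a -> 0 <= b -> semi_inner (sobolev_form a b).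
Proof.
rewrite /sobolev_form => a0 b0; split=> [f g|c f f' g|f].
- by rewrite mulrC (mulrC (laplacian f)) (mulrC f) mulrC.
- by rewrite laplacianD laplacianZ lin_ball lin_sphere; ring.
- by apply: addr_ge0; apply: mulr_ge0 => //; [exact: ball_ge0|exact: (sphere_ge0 G)].
Qed.

(** Uniqueness in the Dirichlet problem: a harmonic polynomial of zero norm on
the sphere has zero Dirichlet energy by Green's identity. *)
Lemma sobolev_definite (a b : R) : 0 < a -> 0 < b -> (0 < d)%N ->
  definite (sobolev_form a b).
Proof.
move=> a0 b0 d0 f /eqP; rewrite /sobolev_form paddr_eq0; last 2 first.
- by apply: mulr_ge0 (ltW a0) (ball_ge0 _).
- by apply: mulr_ge0 (ltW b0) (sphere_ge0 G _).
rewrite !mulf_eq0 (gt_eqF a0) (gt_eqF b0) /= => /andP[/eqP/ball_definite Lf /eqP Sf].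
apply: energy_sphere_definite => //.
have := green_first f f; rewrite Lf mulr0 raddf0 addr0 => ->.
exact: (semi_inner_null sphere_semi).
Qed.

End green_pairs.

Section harmonic.
Context {R : realType} {d : nat}.
Local Notation P := (mpoly d R).
Local Notation X i := (mpolyX R (mnm1 i) : P).
Local Notation w := (one_sub_sqnorm R d).
Local Notation homog k := (ishomog1 k mdeg).
Implicit Types (p q f g h : P) (i j : 'I_d) (k n : nat).

Lemma msize_finite n : exists N (e : 'I_N -> P),
  [set p : P | (msize p <= n)%N] `<=` lspan (range e).
Proof.
exists #|{: bmultinom d n}|, (fun t => mpolyX R (bmnm (enum_val t))) => p /mpolywE ->.
have sp := lin_subspace_lspan
  (range (fun t : 'I_#|{: bmultinom d n}| => mpolyX R (bmnm (enum_val t)))).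
apply: (lin_subspace_sum _ sp) => m _; have [_ _ Z] := sp; apply: Z; apply: sub_lspan.
by exists (enum_rank m) => //; rewrite enum_rankK.
Qed.

Context {IB IS : {scalar P}} (G : green_pair IB IS) (hd : (0 < d)%N).

(** Dirichlet's principle: [w * q] is the projection of [p], for the Dirichlet
energy, on the polynomials of bounded degree that vanish on the sphere. *)
Lemma harmonic_decomposition p :
  exists2 q, (msize q <= msize p - 2)%N & laplacian (p - w * q) = 0.
Proof.
set n := (msize p - 2)%N.
pose A : set P := [set w * q | q in [set q : P | (msize q <= n)%N]].
have sA : lin_subspace A.
  have [S0 SD SZ] := lin_subspace_msize (R := R) (d := d) n; split.
  - by exists (0 : P) => //; rewrite mulr0.
  - by move=> _ _ [q Sq <-] [q' Sq' <-]; exists (q + q'); [exact: SD|rewrite mulrDr].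
  - by move=> c _ [q Sq <-]; exists (c *: q); [exact: SZ|rewrite scalerAr].
have [N [e eA]] := msize_finite n.+2.
have Ae : A `<=` lspan (range e) by move=> _ [q Sq <-]; apply: eA; exact: msize_w_mul.
have [_ [q qn <-] Dq] :=
  orthogonal_projection p (dirichlet_semi G) (dirichlet_definite G hd) sA Ae.
exists q => //; set r := p - w * q in Dq *.
apply: (weighted_ip_definite (k := 1) G).
have Ln : (msize (laplacian r) <= n)%N.
  apply: leq_trans (msize_laplacian r) _; rewrite leq_subLR.
  apply: msizeB_le; first by rewrite /n; lia.
  by rewrite add2n; exact: msize_w_mul.
(* Against this element the projection tests the Laplacian of [r] with itself. *)
have /Dq : A (w * laplacian r) by exists (laplacian r).
rewrite /dirichlet_form grad_dotC (green_w G) [r * _]mulrCA (sphere_w G) addr0.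
by move=> /eqP; rewrite oppr_eq0 /weighted_ip expr1 mulrA => /eqP.
Qed.

(** Green's first identity is symmetric in [Y] and [Z], whereas their normal
derivatives on the sphere are [n] times [Y] and [k] times [Z]. *)
Lemma sphere_harmonic_homog k n Y Z : k != n ->
  Y \is homog n -> laplacian Y = 0 -> Z \is homog k -> laplacian Z = 0 ->
  IS (Y * Z) = 0.
Proof.
move=> kn hY LY hZ LZ.
have := green_first G Y Z; have := green_first G Z Y.
rewrite LY LZ !mulr0 raddf0 !addr0 grad_dotC => -> /eqP.
rewrite (euler_homog hY) (euler_homog hZ) !mulrnAr !raddfMn/= (mulrC Z).
rewrite -[_ *+ n]mulr_natr -[_ *+ k]mulr_natr -subr_eq0 -mulrBr mulf_eq0.
by rewrite subr_eq0 eqr_nat ?[n == k]eq_sym (negPf kn) orbF => /eqP.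
Qed.

(** On the sphere [g] agrees with a harmonic polynomial [h] of no larger degree;
the top component of [h] is harmonic too, and the induction takes care of the
rest. *)
Lemma sphere_harmonic_lower n Y g : Y \is homog n -> laplacian Y = 0 ->
  (msize g <= n)%N -> IS (Y * g) = 0.
Proof.
move=> hY LY; move: (leqnn n); move: {1 3}n => k; elim: k g => [|k IH] g kn gk.
  by move: gk; rewrite leqn0 msize_poly_eq0 => /eqP ->; rewrite mulr0 raddf0.
have [q qg Lh] := harmonic_decomposition g; set h := g - w * q in Lh.
have hk : (msize h <= k.+1)%N.
  apply: (msizeB_le gk).
  have [q0|q0] := eqVneq q 0; first by rewrite q0 mulr0 msize0.
  have := leq_trans (_ : 0 < msize q)%N qg; rewrite lt0n msize_poly_eq0 subn_gt0.
  move=> /(_ q0) g2; apply: leq_trans (msize_w_mul qg) _.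
  by move: gk g2; lia.
have -> : IS (Y * g) = IS (Y * pihomog mdeg k h)
    + IS (Y * (h - pihomog mdeg k h)) + IS (w * (Y * q)).
  rewrite -!(raddfD IS)/= -mulrDr [_ + (h - _)]addrC subrK /h mulrBr.
  by rewrite [Y * (w * q)]mulrCA subrK.
rewrite (sphere_w G) (IH _ (ltnW kn) (msize_sub_pihomog hk)) !addr0.
apply: (sphere_harmonic_homog _ hY LY (pihomogP _ _ _)).
  by rewrite neq_ltn kn.
exact: harmonic_pihomog.
Qed.

(** On a form the ball integral is a positive multiple of the sphere integral. *)
Lemma ball_harmonic_lower n Y g : Y \is homog n -> laplacian Y = 0 ->
  (msize g <= n)%N -> IB (Y * g) = 0.
Proof.
move=> hY LY; move: (leqnn n); move: {1 3}n => k; elim: k g => [|k IH] g kn gk.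
  by move: gk; rewrite leqn0 msize_poly_eq0 => /eqP ->; rewrite mulr0 raddf0.
have -> : IB (Y * g) = IB (Y * pihomog mdeg k g) + IB (Y * (g - pihomog mdeg k g)).
  by rewrite -(raddfD IB)/= -mulrDr [_ + (g - _)]addrC subrK.
rewrite (IH _ (ltnW kn) (msize_sub_pihomog gk)) addr0.
have hg := pihomogP mdeg k g.
have := sphere_homog G (dhomogM hY hg).
rewrite (sphere_harmonic_lower hY LY); last exact: leq_trans (homog_msize_le hg) kn.
by move=> /esym/eqP; rewrite mulf_eq0 pnatr_eq0 addn_eq0 (gtn_eqF hd) => /eqP.
Qed.

End harmonic.

(** * The three pieces and their completeness *)

Section sobolev_basis.
Context {R : realType} {d : nat}.
Local Notation P := (mpoly d R).
Local Notation w := (one_sub_sqnorm R d).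
Local Notation homog k := (ishomog1 k mdeg).
Implicit Types (p q f g h u v Y Q : P) (k n : nat).

(** The truncated subtraction is harmless under the bound on [n]. *)
Lemma piece1P n v : piece1 R d n v <-> (2 <= n)%N /\
  exists Y, [/\ Y \is homog (n - 2)%N, laplacian Y = 0 & v = w * Y].
Proof.
case: n => [|[|n]]; [by split=> [[]|[]]|by split=> [[]|[]]|].
rewrite /piece1 (_ : n.+2%:Z - 2 = Posz n) ?subSS ?subn0; last first.
  by rewrite -addn2 PoszD addrK.
by split=> [[Y [hY LY] <-]|[_ [Y [hY LY ->]]]]; [split=> //|]; exists Y.
Qed.

Lemma piece2P n v : piece2 R d n v <-> (4 <= n)%N /\
  exists Q, [/\ (msize Q <= (n - 4).+1)%N,
    forall g, (msize g <= n - 4)%N -> W2_ip Q g = 0 & v = w ^+ 2 * Q].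
Proof.
case: n => [|[|[|[|n]]]]; do 4?[by split=> [[]|[]]].
rewrite /piece2 (_ : n.+4%:Z - 4 = Posz n) ?subSS ?subn0; last first.
  by rewrite -addn4 PoszD addrK.
by split=> [[Y [hY LY] <-]|[_ [Y [hY LY ->]]]]; [split=> //|]; exists Y.
Qed.

Context {IB IS : {scalar P}} (G : green_pair IB IS) (hd : (0 < d)%N).
Context (lambda a b : R) (a0 : 0 < a) (b0 : 0 < b).
Context (sobolevE : @sobolev_ip R d lambda = sobolev_form (IB := IB) (IS := IS) a b).
Context (W2E : @W2_ip R d = weighted_ip (IB := IB) 2).
Local Notation ip := (@sobolev_ip R d lambda).

Lemma sobolev_ip_semi : semi_inner ip.
Proof. by rewrite sobolevE; apply: sobolev_semi => //; exact: ltW. Qed.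

Lemma sobolev_ip_definite : definite ip.
Proof. by rewrite sobolevE; exact: sobolev_definite. Qed.

Lemma sobolev_w u v : ip (w * u) v = a * IB (laplacian (w * u) * laplacian v).
Proof. by rewrite sobolevE /sobolev_form -mulrA (sphere_w G) mulr0 addr0. Qed.

Lemma sobolev_harmonic Y v : laplacian Y = 0 -> ip Y v = b * IS (Y * v).
Proof. by move=> LY; rewrite sobolevE /sobolev_form LY mul0r raddf0 mulr0 add0r. Qed.

Lemma sobolev_w2 Q v : ip (w ^+ 2 * Q) v = a * W2_ip Q (laplacian (laplacian v)).
Proof.
rewrite expr2 -mulrA sobolev_w mulrA -expr2 (green_w2 G) W2E /weighted_ip.
by rewrite mulrA.
Qed.

Lemma piece0_orthopoly n : piece0 R d n `<=` orthopoly ip n.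
Proof.
move=> Y [hY LY]; split=> [|g gn]; first exact: homog_msize_le.
by rewrite sobolev_harmonic// (sphere_harmonic_lower G hd hY LY gn) mulr0.
Qed.

Lemma piece1_orthopoly n : piece1 R d n `<=` orthopoly ip n.
Proof.
move=> _ /piece1P[n2 [Y [hY LY ->]]]; split=> [|g gn].
  apply: leq_trans (msize_w_mul (homog_msize_le hY)) _; lia.
rewrite sobolev_w (laplacian_w_harmonic hY LY) mulNr mulrnAl raddfN raddfMn/=.
rewrite (ball_harmonic_lower G hd hY LY) ?mul0rn ?oppr0 ?mulr0//.
exact: leq_trans (msize_laplacian g) (leq_sub2r 2 gn).
Qed.

Lemma piece2_orthopoly n : piece2 R d n `<=` orthopoly ip n.
Proof.
move=> _ /piece2P[n4 [Q [sQ oQ ->]]]; split=> [|g gn].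
  rewrite expr2 -mulrA.
  apply: leq_trans (msize_w_mul (msize_w_mul sQ)) _; lia.
rewrite sobolev_w2 oQ ?mulr0//; apply: leq_trans (msize_laplacian _) _.
by have := msize_laplacian g; lia.
Qed.

Lemma piece0_piece1_orthogonal n : orthogonal_sets ip (piece0 R d n) (piece1 R d n).
Proof.
move=> Y _ [hY LY] /piece1P[_ [Z [_ _ ->]]].
by rewrite sobolev_harmonic// mulrCA (sphere_w G) mulr0.
Qed.

Lemma piece0_piece2_orthogonal n : orthogonal_sets ip (piece0 R d n) (piece2 R d n).
Proof.
move=> Y _ [hY LY] /piece2P[_ [Q [_ _ ->]]].
by rewrite sobolev_harmonic// expr2 -mulrA mulrCA (sphere_w G) mulr0.
Qed.

Lemma piece1_piece2_orthogonal n : orthogonal_sets ip (piece1 R d n) (piece2 R d n).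
Proof.
move=> _ _ /piece1P[_ [Y [hY LY ->]]] /piece2P[_ [Q [_ _ ->]]].
rewrite (ipC sobolev_ip_semi) sobolev_w2 (laplacian_w_harmonic hY LY).
rewrite -mulNrn -scaler_nat laplacianZ -scaleN1r laplacianZ LY !scaler0.
by rewrite W2E /weighted_ip mulr0 raddf0 mulr0.
Qed.

Lemma linear_piece0 n : linear_set (piece0 R d n).
Proof.
move=> c Y Z [hY LY] [hZ LZ]; split.
  by apply: rpredD => //; exact: rpredZ.
by rewrite laplacianD laplacianZ LY LZ scaler0 addr0.
Qed.

Lemma linear_piece1 n : linear_set (piece1 R d n).
Proof.
move=> c u v /piece1P[n2 [Y [hY LY ->]]] /piece1P[_ [Z [hZ LZ ->]]].
apply/piece1P; split=> //; exists (c *: Y + Z).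
have [] := @linear_piece0 (n - 2) c Y Z (conj hY LY) (conj hZ LZ).
by split=> //; rewrite mulrDr scalerAr.
Qed.

Lemma linear_piece2 n : linear_set (piece2 R d n).
Proof.
move=> c u v /piece2P[n4 [Q [sQ oQ ->]]] /piece2P[_ [Q' [sQ' oQ' ->]]].
apply/piece2P; split=> //; exists (c *: Q + Q'); split.
- by have [_ D Z] := lin_subspace_msize (R := R) (d := d) (n - 4).+1; apply: D => //; apply: Z.
- move=> g gn; move: (oQ g gn) (oQ' g gn); rewrite W2E.
  by rewrite (ipDl (weighted_ip_semi G 2)) (ipZl (weighted_ip_semi G 2)) => -> ->;
    rewrite mulr0 addr0.
- by rewrite mulrDr scalerAr.
Qed.

Lemma lin_subspace_orthopoly n : lin_subspace (orthopoly ip n).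
Proof.
have [S0 SD SZ] := lin_subspace_msize (R := R) (d := d) n.+1; split.
- by split=> // g _; exact: (ip0l sobolev_ip_semi).
- move=> u v [su ou] [sv ov]; split=> [|g gn]; first exact: SD.
  by rewrite (ipDl sobolev_ip_semi) ou// ov// addr0.
- move=> c v [sv ov]; split=> [|g gn]; first exact: SZ.
  by rewrite (ipZl sobolev_ip_semi) ov// mulr0.
Qed.

Lemma VWm2_orthopoly n : lspan (VWm2 R d n) `<=` orthopoly ip n.
Proof.
apply: lspan_sub (lin_subspace_orthopoly n) _ => v [[]|].
- exact: piece0_orthopoly.
- exact: piece1_orthopoly.
- exact: piece2_orthopoly.
Qed.

Lemma harmonic_top n h : (msize h <= n.+1)%N -> laplacian h = 0 ->
  exists Y, [/\ Y \is homog n, laplacian Y = 0 & (msize (h - Y) <= n)%N].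
Proof.
move=> hn Lh; exists (pihomog mdeg n h); split.
- exact: pihomogP.
- exact: harmonic_pihomog.
- exact: msize_sub_pihomog.
Qed.

(** Subtracting from [q] its projection on lower degree makes it an orthogonal
polynomial without changing its top component. *)
Lemma piece2_top n q : (msize q <= n.+1 - 4)%N ->
  exists2 v, lspan (piece2 R d n) v & (msize (w ^+ 2 * q - v) <= n)%N.
Proof.
move=> qn; have [L0 _ _] := lin_subspace_lspan (piece2 R d n).
have [n4|n4] := leqP 4 n; last first.
  exists 0; first exact: L0.
  have /eqP : msize q = 0%N by apply/eqP; rewrite -leqn0; apply: leq_trans qn _; lia.
  by rewrite msize_poly_eq0 => /eqP ->; rewrite mulr0 subr0 msize0.
have [N [e eA]] := msize_finite (R := R) (d := d) (n - 4).
have [u su ou] := orthogonal_projection q (weighted_ip_semi G 2)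
  (weighted_ip_definite (k := 2) G) (lin_subspace_msize _) eA.
exists (w ^+ 2 * (q - u)).
  apply: sub_lspan; apply/piece2P; split=> //; exists (q - u); split=> //.
    apply: msizeB_le; first by apply: leq_trans qn _; lia.
    exact: leqW.
  by move=> g gn; rewrite W2E; exact: ou.
rewrite mulrBr opprB addrC subrK expr2 -mulrA.
apply: leq_trans (msize_w_mul (msize_w_mul su)) _; lia.
Qed.

(** Two successive decompositions, [f = h + w * q] and [q = h' + w * q'], from which
only the components of top degree are kept. *)
Lemma VWm2_top n f : (msize f <= n.+1)%N ->
  exists2 v, lspan (VWm2 R d n) v & (msize (f - v) <= n)%N.
Proof.
move=> fn; have [L0 LD _] := lin_subspace_lspan (VWm2 R d n).
have [q qf Lh] := harmonic_decomposition G hd f.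
have qn : (msize q <= n.+1 - 2)%N by apply: leq_trans qf (leq_sub2r _ fn).
have hn : (msize (f - w * q) <= n.+1)%N.
  apply: (msizeB_le fn); have [->|q0] := eqVneq q 0.
    by rewrite mulr0 msize0.
  have q1 : (0 < msize q)%N by rewrite lt0n msize_poly_eq0.
  apply: leq_trans (msize_w_mul qn) _; move: (leq_trans q1 qn); lia.
have [Y [hY LY sY]] := harmonic_top hn Lh.
suff [v Lv sv] : exists2 v, lspan (VWm2 R d n) v & (msize (w * q - v) <= n)%N.
  exists (Y + v).
    by apply: LD => //; apply: sub_lspan; left; left.
  have -> : f - (Y + v) = (f - w * q - Y) - (v - w * q).
    by ring.
  apply: (msizeB_le sY); rewrite -msizeN opprB; exact: sv.
(* Below degree two there is no room for a quotient [q]. *)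
have [n2|n2] := leqP 2 n; last first.
  exists 0 => //.
  have /eqP : msize q = 0%N by apply/eqP; rewrite -leqn0; apply: leq_trans qn _; lia.
  by rewrite msize_poly_eq0 => /eqP ->; rewrite mulr0 subr0 msize0.
have [q' qq' Lh'] := harmonic_decomposition G hd q.
have qn' : (msize q <= (n - 2).+1)%N by apply: leq_trans qn _; lia.
have q'n : (msize q' <= n.+1 - 4)%N.
  by apply: leq_trans qq' _; move: qn; lia.
have hn' : (msize (q - w * q') <= (n - 2).+1)%N.
  apply: (msizeB_le qn'); have [->|q0] := eqVneq q' 0.
    by rewrite mulr0 msize0.
  have q1 : (0 < msize q')%N by rewrite lt0n msize_poly_eq0.
  apply: leq_trans (msize_w_mul q'n) _; move: (leq_trans q1 q'n); lia.
have [Y' [hY' LY' sY']] := harmonic_top hn' Lh'.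
have [v Lv sv] := piece2_top q'n.
exists (w * Y' + v).
  apply: LD; last by apply: lspanS Lv => u pu; right.
  by apply: sub_lspan; left; right; apply/piece1P; split=> //; exists Y'.
have -> : w * q - (w * Y' + v) = w * (q - w * q' - Y') - (v - w ^+ 2 * q').
  by ring.
apply: msizeB_le.
  by apply: leq_trans (msize_w_mul sY') _; lia.
rewrite -msizeN opprB; exact: sv.
Qed.

(** Modulo lower degree the three pieces exhaust all polynomials of degree [n];
what remains is orthogonal to itself. *)
Lemma lspan_VWm2 n : lspan (VWm2 R d n) = orthopoly ip n.
Proof.
apply/seteqP; split=> [|f [sf of_]]; first exact: VWm2_orthopoly.
have [v Lv sv] := VWm2_top sf; have [_ ov] := VWm2_orthopoly Lv.
suff /eqP : f - v = 0 by rewrite subr_eq0 => /eqP ->.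
by apply: sobolev_ip_definite; rewrite (ipBl sobolev_ip_semi) of_// ov// subrr.
Qed.

Lemma VWm2_structure n :
  [/\ lspan (VWm2 R d n) `<=` orthopoly (sobolev_ip lambda) n,
      (exists (m : nat) (b : 'I_m -> mpoly d R),
        [/\ forall i, VWm2 R d n (b i),
            orthonormal_family (sobolev_ip lambda) b
          & lspan (range b) = orthopoly (sobolev_ip lambda) n])
    & orthogonal_direct_sum3 (sobolev_ip lambda) (lspan (VWm2 R d n))
        (lspan (piece0 R d n)) (lspan (piece1 R d n)) (lspan (piece2 R d n))].
Proof.
have [N [e eA]] := msize_finite (R := R) (d := d) n.+1.
split; first exact: VWm2_orthopoly.
  rewrite -lspan_VWm2; apply: (orthonormal_basis_setU3 (e := e)).
  - exact: sobolev_ip_semi.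
  - exact: sobolev_ip_definite.
  - exact: linear_piece0.
  - exact: linear_piece1.
  - exact: linear_piece2.
  - exact: piece0_piece1_orthogonal.
  - exact: piece0_piece2_orthogonal.
  - exact: piece1_piece2_orthogonal.
  - by move=> v /sub_lspan/VWm2_orthopoly[sv _]; exact: eA.
apply: orthogonal_direct_sum3_lspan.
- exact: sobolev_ip_semi.
- exact: sobolev_ip_definite.
- exact: piece0_piece1_orthogonal.
- exact: piece0_piece2_orthogonal.
- exact: piece1_piece2_orthogonal.
Qed.

End sobolev_basis.

(** * Volume of the ball *)

Section ball_volume.
Context {R : realType}.
Implicit Types (d : nat) (s c : R).
Local Notation leb := (@lebesgue_measure R).

Definition sqn d (x : euclid R d) : R := \sum_(i < d) tnth x i ^+ 2.

Definition sq_ball d s : set (euclid R d) := [set x | sqn x <= s].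

(** Cubes have a volume that is immediate by induction on the dimension, and they
squeeze the ball. *)
Definition cube d c : set (euclid R d) := [set x | forall i, `|tnth x i| <= c].

Lemma sqn_ge0 d (x : euclid R d) : 0 <= sqn x.
Proof. by apply: sumr_ge0 => i _; exact: sqr_ge0. Qed.

Lemma sqr_coord_le d (x : euclid R d) i : tnth x i ^+ 2 <= sqn x.
Proof.
rewrite /sqn (bigD1 i)//= lerDl; apply: sumr_ge0 => j _; exact: sqr_ge0.
Qed.

Lemma enorm_ge0 d (x : euclid R d) : 0 <= enorm x.
Proof. exact: sqrtr_ge0. Qed.

Lemma sqr_enorm d (x : euclid R d) : enorm x ^+ 2 = sqn x.
Proof. by rewrite sqr_sqrtr// sqn_ge0. Qed.

Lemma unit_ballE d : unit_ball R d = @sq_ball d 1.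
Proof.
apply/seteqP; split => x; rewrite /unit_ball /sq_ball/= -sqr_enorm.
  by move=> x1; rewrite expr_le1// enorm_ge0.
by rewrite expr_le1// enorm_ge0.
Qed.

Lemma tnth_cons0 d t (x : euclid R d) : tnth (euclid_cons (t, x)) ord0 = t.
Proof. exact: tnth0. Qed.

Lemma tnth_consS d t (x : euclid R d) i :
  tnth (euclid_cons (t, x)) (lift ord0 i) = tnth x i.
Proof. exact: tnthS. Qed.

Lemma sqn_cons d t (x : euclid R d) : sqn (euclid_cons (t, x)) = t ^+ 2 + sqn x.
Proof.
rewrite /sqn big_ord_recl tnth_cons0; congr (_ + _).
by apply: eq_bigr => i _; rewrite tnth_consS.
Qed.

Lemma measurable_sqn d : measurable_fun [set: euclid R d] (@sqn d).
Proof. by apply: measurable_sum => i; apply: measurable_funX; exact: measurable_tnth. Qed.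

Lemma measurable_sq_ball d s : measurable (@sq_ball d s).
Proof.
rewrite (_ : @sq_ball d s = setT `&` @sqn d @^-1` [set` `]-oo, s]]).
  exact: measurable_sqn.
by rewrite setTI; apply/seteqP; split => x; rewrite /sq_ball /= in_itv.
Qed.


Lemma cube_cons d c : @euclid_cons R d @^-1` (@cube d.+1 c) = `[- c, c] `*` @cube d c.
Proof.
apply/seteqP; split=> -[t x] /=.
  move=> xc; split=> /=.
    by have := xc ord0; rewrite tnth_cons0 in_itv/= ler_norml.
  by move=> i; have := xc (lift ord0 i); rewrite tnth_consS.
rewrite in_itv/= -ler_norml => -[tc xc] i.
have [j ->|->] := unliftP ord0 i; last by rewrite tnth_cons0.
by rewrite tnth_consS.
Qed.

Lemma measurable_cube d c : measurable (@cube d c).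
Proof.
rewrite (_ : @cube d c = \bigcap_(i in [set: 'I_d])
    ((fun x : euclid R d => tnth x i) @^-1` `[- c, c])).
  apply: fin_bigcap_measurable => // i _; rewrite -[Y in measurable Y]setTI.
  exact: measurable_tnth.
apply/seteqP; split=> x /= xc i; last by have := xc i I; rewrite /= in_itv/= ler_norml.
by move=> _; rewrite /= in_itv/= -ler_norml.
Qed.

Lemma volume_cube d c : 0 <= c -> lebesgue_d d (@cube d c) = ((2 * c) ^+ d)%:E.
Proof.
move=> c0; elim: d => [|d IH].
  rewrite /= diracE mem_set//; by case.
rewrite /= /lebesgue_succ /pushforward cube_cons product_measure1E//=; last first.
  exact: measurable_cube.
rewrite IH lebesgue_measure_itv/= lte_fin exprS EFinM.
have [->|c1] := eqVneq c 0; first by rewrite oppr0 ltxx mulr0.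
by rewrite gtrN ?lt0r ?c1// -EFinD opprK mulr2n mulrDl !mul1r.
Qed.

Lemma sq_ball_sub_cube d s : @sq_ball d s `<=` @cube d (1 + `|s|).
Proof.
move=> x xs i; have xi := le_trans (sqr_coord_le x i) xs.
rewrite -ler_sqr ?nnegrE ?addr_ge0// real_normK ?num_real//.
have : s <= `|s| by exact: ler_norm.
have : 0 <= `|s| by [].
by move: (`|s|) => u; nra.
Qed.

Lemma cube_sub_ball d : @cube d (d%:R^-1) `<=` unit_ball R d.
Proof.
move=> x xc; rewrite unit_ballE /sq_ball/=.
have [d0|d0] := posnP d.
  rewrite /sqn big1 ?ler01// => i _.
  by have := leq_trans (ltn_ord i) (eq_leq d0).
apply: (@le_trans _ _ (\sum_(i < d) d%:R^-1)).
  apply: ler_sum => i _.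
  rewrite -[tnth x i ^+ 2]real_normK ?num_real//.
  apply: (@le_trans _ _ (d%:R^-1 ^+ 2)).
    by rewrite ler_sqr ?nnegrE// invr_ge0.
  rewrite expr2 ger_pMl ?invr_gt0 ?ltr0n//.
  by rewrite invf_le1 ?ltr0n// ler1n.
by rewrite sumr_const card_ord -[_ *+ d]mulr_natr mulVf// pnatr_eq0 gtn_eqF.
Qed.

Lemma volume_sq_ball_lty d s : (lebesgue_d d (@sq_ball d s) < +oo)%E.
Proof.
apply: (@le_lt_trans _ _ (lebesgue_d d (@cube d (1 + `|s|)))).
  apply: le_measure; rewrite ?inE; [exact: measurable_sq_ball|exact: measurable_cube|].
  exact: sq_ball_sub_cube.
by rewrite volume_cube ?ltry// addr_ge0.
Qed.

Lemma volume_ball_gt0 d : (0 < lebesgue_d d (unit_ball R d))%E.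
Proof.
apply: (@lt_le_trans _ _ (lebesgue_d d (@cube d d%:R^-1))).
  rewrite volume_cube ?invr_ge0// lte_fin.
  by case: d => [|d]; rewrite ?expr0// exprn_gt0// mulr_gt0// invr_gt0 ltr0n.
apply: le_measure; rewrite ?inE; [exact: measurable_cube|exact: measurable_unit_ball|].
exact: cube_sub_ball.
Qed.

Lemma measurable_peval d (p : mpoly d R) : measurable_fun [set: euclid R d] (peval p).
Proof.
rewrite (_ : peval p = fun x : euclid R d => \sum_(m <- msupp p)
    mcoeff m p * \prod_(i < d) tnth x i ^+ m i); last first.
  by apply/funext => x; rewrite /peval mevalE.
apply: measurable_sum => m; apply: measurable_funM => //.
by apply: measurable_prod => i _; apply: measurable_funX; exact: measurable_tnth.
Qed.

Lemma peval_bounded d (p : mpoly d R) c (x : euclid R d) : 0 <= c -> @cube d c x ->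
  `|peval p x| <= \sum_(m <- msupp p) `|mcoeff m p| * c ^+ mdeg m.
Proof.
move=> c0 xc; rewrite /peval mevalE; apply: le_trans (ler_norm_sum _ _ _) _.
apply: ler_sum => m _; rewrite normrM ler_wpM2l// normr_prod mdegE.
rewrite -prodrXr; apply: ler_prod => i _.
by rewrite normr_ge0 normrX lerXn2r ?nnegrE// xc.
Qed.

Lemma integrable_bounded d (D : set (euclid R d)) (f : euclid R d -> R) (M : R) s :
  measurable D -> D `<=` @sq_ball d s -> measurable_fun [set: euclid R d] f ->
  (forall x, D x -> `|f x| <= M) -> (lebesgue_d d).-integrable D (EFin \o f).
Proof.
move=> mD Ds mf fM; apply: measurable_bounded_integrable => //.
- apply: le_lt_trans (volume_sq_ball_lty d s).
  by apply: le_measure; rewrite ?inE//; exact: measurable_sq_ball.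
- exact: measurable_funTS.
- exists M; split; first exact: num_real.
  by move=> K MK x Dx; apply: le_trans (fM x Dx) (ltW MK).
Qed.

Lemma integrable_peval d (p : mpoly d R) s :
  (lebesgue_d d).-integrable (@sq_ball d s) (EFin \o peval p).
Proof.
apply: (integrable_bounded (s := s)
  (M := \sum_(m <- msupp p) `|mcoeff m p| * (1 + `|s|) ^+ mdeg m)).
- exact: measurable_sq_ball.
- by [].
- exact: measurable_peval.
- by move=> x /sq_ball_sub_cube; apply: peval_bounded; rewrite addr_ge0.
Qed.

End ball_volume.

(** * The divergence theorem on the ball *)

Lemma integral_patch dd (T : measurableType dd) (R : realType)
    (mu : {measure set T -> \bar R}) (D : set T) (g : T -> R) :
  (\int[mu]_x ((g \_ D) x)%:E = \int[mu]_(x in D) (g x)%:E)%E.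
Proof. by rewrite [RHS]integral_mkcond restrict_EFin. Qed.

Section iterated_integrals.
Context {R : realType} {d : nat}.
Local Notation leb := (@lebesgue_measure R).
Local Open Scope ereal_scope.
Implicit Types (f : euclid R d.+1 -> \bar R).

Lemma ge0_integral_lebesgue_succ f :
  measurable_fun setT f -> (forall x, 0 <= f x) ->
  \int[lebesgue_d d.+1]_x f x =
  \int[(leb \x lebesgue_d d)]_z f (euclid_cons z).
Proof.
move=> mf f0; rewrite /=.
rewrite ge0_integral_pushforward//; exact: measurable_euclid_cons.
Qed.

Lemma integrable_euclid_cons f :
  (lebesgue_d d.+1).-integrable setT f ->
  (leb \x lebesgue_d d).-integrable setT (f \o @euclid_cons R d).
Proof.
move=> /integrableP[mf foo]; apply/integrableP; split.
  by apply: measurableT_comp => //; exact: measurable_euclid_cons.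
have /= <- := @ge0_integral_lebesgue_succ (abse \o f) => //.
exact: measurableT_comp.
Qed.

Lemma integral_lebesgue_succ f : (lebesgue_d d.+1).-integrable setT f ->
  \int[lebesgue_d d.+1]_x f x =
  \int[(leb \x lebesgue_d d)]_z f (euclid_cons z).
Proof.
move=> If; rewrite /= integral_pushforward//.
- exact: measurable_euclid_cons.
- exact: measurable_int If.
- exact: integrable_euclid_cons.
Qed.

Lemma integral_eq0_outer f : (lebesgue_d d.+1).-integrable setT f ->
  (forall t, \int[lebesgue_d d]_x f (euclid_cons (t, x)) = 0) ->
  \int[lebesgue_d d.+1]_x f x = 0.
Proof.
move=> If f0; rewrite integral_lebesgue_succ//.
rewrite -(integral12_prod_meas1 (integrable_euclid_cons If)).
by rewrite integral0_eq// => t _; exact: f0.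
Qed.

Lemma integral_eq0_inner f : (lebesgue_d d.+1).-integrable setT f ->
  (forall x, \int[leb]_t f (euclid_cons (t, x)) = 0) ->
  \int[lebesgue_d d.+1]_x f x = 0.
Proof.
move=> If f0; rewrite integral_lebesgue_succ//.
rewrite -(integral21_prod_meas1 (integrable_euclid_cons If)).
by rewrite integral0_eq// => t _; exact: f0.
Qed.

End iterated_integrals.

Section divergence_ball.
Context {R : realType}.
Local Notation leb := (@lebesgue_measure R).

Lemma integral_deriv_poly (p : {poly R}) (a b : R) : a < b ->
  (\int[leb]_(t in `[a, b]) (p^`().[t])%:E = (p.[b] - p.[a])%:E)%E.
Proof.
move=> ab; rewrite EFinB; apply: (continuous_FTC2 ab (F := horner p)).
- by apply: continuous_subspaceT; exact: continuous_horner.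
- split.
  + by move=> x _; exact: derivable_horner.
  + by apply: cvg_at_right_filter; exact: continuous_horner.
  + by apply: cvg_at_left_filter; exact: continuous_horner.
- by move=> x _; rewrite -derivE.
Qed.

(** The primitive [k * (c - t ^+ 2) * t ^+ n] vanishes at both ends of the segment. *)
Lemma integral_deriv_segment (k c : R) (n : nat) :
  (\int[leb]_t ((fun t => k * (n%:R * t ^+ n.-1 * (c - t ^+ 2) - 2 * t ^+ n.+1))
     \_ [set t | (t ^+ 2 <= c)%R] t)%:E = 0)%E.
Proof.
have [c0|c0|c0] := ltgtP c 0.
- rewrite integral0_eq// => t _; rewrite patchE memNset//= => tc.
  by have := le_lt_trans tc c0; rewrite ltNge sqr_ge0.
- have E : [set t : R | t ^+ 2 <= c] = `[- Num.sqrt c, Num.sqrt c]%classic.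
    apply/seteqP; split=> t /=; rewrite in_itv/= -ler_norml.
      by move=> tc; rewrite -sqrtr_sqr ler_wsqrtr.
    move=> tc; rewrite -[t ^+ 2]real_normK ?num_real// -(sqr_sqrtr (ltW c0)).
    by rewrite ler_sqr ?nnegrE ?sqrtr_ge0.
  rewrite integral_patch E.
  pose p : {poly R} := (k%:P * ('X^n * (c%:P - 'X^2))).
  transitivity (\int[leb]_(t in `[(- Num.sqrt c)%R, (Num.sqrt c)%R]) (p^`().[t])%:E)%E.
    apply: eq_integral => t _; congr EFin.
    rewrite /p derivM derivC mul0r add0r derivM derivB derivC !derivXn.
    rewrite !hornerE /= hornerMn hornerXn (exprS _ n) mulrN.
    congr (_ * (_ - _)); first by rewrite mulr_natl.
    by rewrite mulrA mulrC mulr_natl mulr2n mulrDr.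
  rewrite integral_deriv_poly ?gtrN ?sqrtr_gt0// /p !hornerE sqrrN.
  by rewrite /= sqr_sqrtr ?ltW// subrr !mulr0 subrr.
- rewrite c0 (_ : [set t : R | t ^+ 2 <= 0] = [set 0]).
    by rewrite integral_patch integral_set1.
  apply/seteqP; split=> t /=; last by move=> ->; rewrite expr0n.
  by move=> t0; apply/eqP; rewrite -sqrf_eq0 eq_le t0 sqr_ge0.
Qed.

(** This is [k] times the partial derivative along [i] of the product of
[s - |x|^2] and the monomial with exponents [e]. When [e i] is zero the truncated
exponent does not matter, because of the factor [(e i)%:R]. *)
Definition div_term d (e : 'I_d -> nat) i (s k : R) (x : euclid R d) : R :=
  k * ((e i)%:R * (\prod_j tnth x j ^+ (e j - (i == j))) * (s - sqn x)
       - 2 * \prod_j tnth x j ^+ (e j + (i == j))).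

Lemma peval_mono d (e : 'I_d -> nat) (x : euclid R d) :
  peval (\prod_j mpolyX R (mnm1 j) ^+ e j) x = \prod_j tnth x j ^+ e j.
Proof.
rewrite /peval rmorph_prod; apply: eq_bigr => j _.
by rewrite rmorphXn/= mevalXU.
Qed.

Lemma peval_sqnorm d (x : euclid R d) : peval sqnorm x = sqn x.
Proof.
rewrite /peval /sqnorm rmorph_sum; apply: eq_bigr => j _.
by rewrite rmorphXn/= mevalXU.
Qed.

Lemma integrable_div_term d (e : 'I_d -> nat) i (s k : R) :
  (lebesgue_d d).-integrable setT (EFin \o (div_term e i s k \_ (@sq_ball R d s))).
Proof.
rewrite -restrict_EFin; apply/integrable_restrict => //.
  exact: measurable_sq_ball.
rewrite setTI.
pose p : mpoly d R := k *: ((e i)%:R *: (\prod_j mpolyX R (mnm1 j) ^+ (e j - (i == j)))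
  * (mpolyC d s - sqnorm) - 2 *: \prod_j mpolyX R (mnm1 j) ^+ (e j + (i == j))).
rewrite (_ : div_term _ _ _ _ = peval p); first exact: integrable_peval.
apply/funext => x; rewrite /div_term -!(peval_mono (fun j => _)) -peval_sqnorm.
by rewrite /p /peval mevalZ mevalB mevalZ mevalM mevalZ mevalB mevalC.
Qed.

(** The first factor [s - |x|^2] vanishes on the boundary of the ball, so that
each integral of the derivative along a chord vanishes; the chords parallel to
the other axes lie in the balls of lower dimension that slice the ball. *)
Lemma integral_div_term d (e : 'I_d -> nat) i (s k : R) :
  (\int[lebesgue_d d]_x ((div_term e i s k \_ (@sq_ball R d s)) x)%:E = 0)%E.
Proof.
elim: d e i s k => [|d IH] e i s k; first by case: i.
have memE t (x : euclid R d) : (euclid_cons (t, x) \in @sq_ball R d.+1 s) =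
    (t ^+ 2 + sqn x <= s).
  by apply/idP/idP; rewrite inE /sq_ball/= sqn_cons.
have [j ->|->] := unliftP ord0 i.
- apply: integral_eq0_outer; first exact: integrable_div_term.
  move=> t; rewrite -[RHS](IH (e \o lift ord0) j (s - t ^+ 2) (k * t ^+ e ord0)).
  apply: eq_integral => x _; congr EFin; rewrite !patchE memE.
  have -> : (x \in @sq_ball R d (s - t ^+ 2)) = (t ^+ 2 + sqn x <= s).
    by rewrite [_ + sqn x]addrC -lerBrDr; apply/idP/idP; rewrite inE.
  case: ifP => // _; rewrite /div_term !big_ord_recl sqn_cons /= !tnth_cons0.
  under eq_bigr do rewrite tnth_consS (inj_eq (@lift_inj _ _)).
  under [X in _ - 2 * (_ * X)]eq_bigr do rewrite tnth_consS (inj_eq (@lift_inj _ _)).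
  by rewrite subn0 addn0; ring.
- apply: integral_eq0_inner; first exact: integrable_div_term.
  move=> x; rewrite -[RHS](integral_deriv_segment
    (k * \prod_j tnth x j ^+ e (lift ord0 j)) (s - sqn x) (e ord0)).
  apply: eq_integral => t _; congr EFin; rewrite !patchE memE.
  have -> : (t \in [set t : R | t ^+ 2 <= s - sqn x]) = (t ^+ 2 + sqn x <= s).
    by rewrite -lerBrDr; apply/idP/idP; rewrite inE.
  case: ifP => // _; rewrite /div_term !big_ord_recl sqn_cons /= !tnth_cons0.
  under eq_bigr do rewrite tnth_consS subn0.
  under [X in _ - 2 * (_ * X)]eq_bigr do rewrite tnth_consS addn0.
  by rewrite subn1 addn1; ring.
Qed.

End divergence_ball.

(** * Homotheties and polar coordinates *)

Section scaling.
Context {R : realType}.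
Local Notation leb := (@lebesgue_measure R).

Definition scale d (r : R) (x : euclid R d) : euclid R d :=
  [tuple r * tnth x i | i < d].

Lemma measurable_scale d r : measurable_fun [set: euclid R d] (@scale d r).
Proof.
apply/measurable_fun_tnthP => i.
rewrite (_ : _ \o _ = fun x => r * tnth x i); last first.
  by apply/funext => x /=; rewrite tnth_mktuple.
by apply: measurable_funM => //; exact: measurable_tnth.
Qed.

Lemma scale_cons d r t (x : euclid R d) :
  scale r (euclid_cons (t, x)) = euclid_cons (r * t, scale r x).
Proof.
apply: eq_from_tnth => i; rewrite tnth_mktuple.
have [j ->|->] := unliftP ord0 i; last by rewrite !tnth_cons0.
by rewrite !tnth_consS tnth_mktuple.
Qed.

Let homothety (r : R) (t : measurableTypeR R) : measurableTypeR R := (r * t)%R.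

Let measurable_mul (r : R) : measurable_fun setT (homothety r).
Proof. exact: measurable_funM. Qed.

Lemma lebesgue_measure_scale (r : R) (A : set (measurableTypeR R)) : 0 < r -> measurable A ->
  leb A = (r%:E * pushforward leb (homothety r) A)%E.
Proof.
move=> r0 mA.
pose nu' := (measure_function_pushforward__canonical__measure_function_Measure
  leb (measurable_mul r)).
rewrite (lebesgue_measure_unique (mu := mscale (NngNum (ltW r0)) nu')) => [//|_ [[a b] /= _ <-]|//].
rewrite /mscale /= /pushforward.
rewrite (_ : _ @^-1` _ = `]a / r, b / r]%classic); last first.
  apply/seteqP; split=> t /=; rewrite !in_itv/=.
    by rewrite /homothety ltr_pdivrMr// ler_pdivlMr// mulrC.
  by rewrite /homothety ltr_pdivrMr// ler_pdivlMr// mulrC.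
rewrite !lebesgue_measure_itv /= !lte_fin ltr_pM2r ?invr_gt0//.
case: ifP => _; last by rewrite mule0.
by rewrite -!EFinB -EFinM -mulrBl mulrCA mulfV ?gt_eqF// mulr1.
Qed.

Lemma ge0_integral_scale1 (r : R) (f : measurableTypeR R -> \bar R) : 0 < r ->
  measurable_fun setT f -> (forall t, 0 <= f t)%E ->
  (\int[leb]_t f t = r%:E * \int[leb]_t f (r * t)%R)%E.
Proof.
move=> r0 mf f0.
pose nu' := (measure_function_pushforward__canonical__measure_function_Measure
  leb (measurable_mul r)).
rewrite (eq_measure_integral (mscale (NngNum (ltW r0)) nu')) => [|A mA _]; last first.
  exact: lebesgue_measure_scale.
rewrite ge0_integral_mscale//=; congr (_ * _)%E.
by rewrite ge0_integral_pushforward.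
Qed.

(** One coordinate at a time, by Tonelli's theorem. *)
Lemma ge0_integral_scale d (r : R) (f : euclid R d -> \bar R) : 0 < r ->
  measurable_fun setT f -> (forall t, 0 <= f t)%E ->
  (\int[lebesgue_d d]_x f x = (r ^+ d)%:E * \int[lebesgue_d d]_x f (scale r x))%E.
Proof.
move=> r0; elim: d f => [|d IH] f mf f0.
  rewrite expr0 mul1e; apply: eq_integral => x _; congr f.
  by apply: eq_from_tnth => -[].
have mfs : measurable_fun setT (f \o @scale d.+1 r).
  by apply: measurableT_comp => //; exact: measurable_scale.
rewrite ge0_integral_lebesgue_succ// (ge0_integral_lebesgue_succ mfs (fun=> f0 _)).
have mfc : measurable_fun setT (f \o @euclid_cons R d).
  by apply: measurableT_comp => //; exact: measurable_euclid_cons.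
have mfsc : measurable_fun setT (f \o @scale d.+1 r \o @euclid_cons R d).
  by apply: measurableT_comp => //; exact: measurable_euclid_cons.
have -> := fubini_tonelli1 (m1 := leb) (m2 := lebesgue_d d) _ mfc (fun z => f0 _).
have -> := fubini_tonelli1 (m1 := leb) (m2 := lebesgue_d d) _ mfsc (fun z => f0 _).
rewrite /fubini_F /=.
rewrite (ge0_integral_scale1 r0); last 2 first.
- have mF := measurable_fun_fubini_tonelli_F (m2 := lebesgue_d d) _ mfc (fun z => f0 _); exact: mF.
- by move=> t; exact: integral_ge0.
rewrite exprS EFinM -muleA; congr (_ * _)%E.
rewrite -ge0_integralZl//; last 3 first.
- have mF := measurable_fun_fubini_tonelli_F (m2 := lebesgue_d d) _ mfsc (fun z => f0 _); exact: mF.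
- by move=> t _; exact: integral_ge0.
- by rewrite lee_fin exprn_ge0// ltW.
apply: eq_integral => t _; rewrite (IH (fun x => f (euclid_cons (r * t, x))))//.
  by congr (_ * _)%E; apply: eq_integral => x _; rewrite scale_cons.
apply: measurableT_comp => //; apply: measurableT_comp.
  exact: measurable_euclid_cons.
exact: measurable_pair1.
Qed.

Lemma sqn_scale d r (x : euclid R d) : sqn (scale r x) = r ^+ 2 * sqn x.
Proof.
by rewrite /sqn mulr_sumr; apply: eq_bigr => i _; rewrite tnth_mktuple exprMn.
Qed.

Lemma integral_scale d (r : R) (f : euclid R d -> R) : 0 < r ->
  measurable_fun setT f ->
  (lebesgue_d d).-integrable setT (EFin \o (f \o scale r)) ->
  (\int[lebesgue_d d]_x (f x)%:E =
    (r ^+ d)%:E * \int[lebesgue_d d]_x (f (scale r x))%:E)%E.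
Proof.
move=> r0 mf If; have mEf : measurable_fun setT (EFin \o f) by exact/measurable_EFinP.
have If' : (lebesgue_d d).-integrable setT ((EFin \o f) \o scale r) by [].
rewrite [LHS]integralE.
rewrite (ge0_integral_scale r0 (measurable_funepos mEf))//.
rewrite (ge0_integral_scale r0 (measurable_funeneg mEf))//.
rewrite -[fun x => (_^\+)%E _]/((EFin \o f)^\+ \o scale r)%E.
rewrite -[fun x => (_^\-)%E _]/((EFin \o f)^\- \o scale r)%E.
rewrite -funepos_comp -funeneg_comp -muleBr//; last first.
  exact/fin_num_adde_defr/(integrable_pos_fin_num measurableT If').
by congr (_ * _)%E; rewrite [RHS]integralE.
Qed.

Lemma Rintegral_scale d (r k : R) (f : euclid R d -> R) : 0 < r ->
  measurable_fun setT f -> (forall x, f (scale r x) = k * f x) ->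
  (lebesgue_d d).-integrable (@sq_ball R d 1) (EFin \o f) ->
  \int[lebesgue_d d]_(x in @sq_ball R d (r ^+ 2)) f x =
  r ^+ d * k * \int[lebesgue_d d]_(x in @sq_ball R d 1) f x.
Proof.
move=> r0 mf fr If.
have fsE : (f \_ @sq_ball R d (r ^+ 2)) \o scale r =
    (fun x => k * f x) \_ @sq_ball R d 1.
  apply/funext => x; rewrite /= !patchE fr.
  suff -> : (scale r x \in @sq_ball R d (r ^+ 2)) = (x \in @sq_ball R d 1) by [].
  by apply/idP/idP; rewrite !inE /sq_ball/= sqn_scale ger_pMr// exprn_gt0.
have Ifk : (lebesgue_d d).-integrable (@sq_ball R d 1) (EFin \o (fun x => k * f x)).
  exact: (integrableZl (measurable_sq_ball 1) k If).
rewrite -mulrA -RintegralZl//; last exact: measurable_sq_ball.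
rewrite /Rintegral -integral_patch (integral_scale r0); last 2 first.
- by apply/measurable_restrict => //; [exact: measurable_sq_ball|exact: measurable_funTS].
- rewrite fsE -restrict_EFin; apply/integrable_restrict => //.
    exact: measurable_sq_ball.
  by rewrite setTI.
rewrite -[fun x => _]/(fun x => (((f \_ @sq_ball R d (r ^+ 2)) \o scale r) x)%:E) fsE.
rewrite integral_patch fineM//; apply: integrable_fin_num => //.
exact: measurable_sq_ball.
Qed.

End scaling.

Section polar_coordinates.
Context {R : realType}.

Lemma enorm_scale d (r : R) (x : euclid R d) : 0 < r ->
  enorm (scale r x) = r * enorm x.
Proof.
move=> r0; rewrite /enorm -/(sqn _) sqn_scale sqrtrM ?sqr_ge0//.
by rewrite sqrtr_sqr gtr0_norm.
Qed.

Lemma radial_scale d (r : R) (x : euclid R d) : 0 < r ->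
  radial (scale r x) = radial x.
Proof.
move=> r0; apply: eq_from_tnth => i; rewrite !tnth_mktuple enorm_scale//.
by rewrite invfM mulrACA divff ?gt_eqF// mul1r.
Qed.

Lemma enorm_radial d (x : euclid R d) : 0 < enorm x -> enorm (radial x) = 1.
Proof.
move=> x0; have -> : radial x = scale (enorm x)^-1 x.
  by apply: eq_from_tnth => i; rewrite !tnth_mktuple mulrC.
by rewrite enorm_scale ?invr_gt0// mulVf// gt_eqF.
Qed.

Definition monomial d (m : multinom d) (x : euclid R d) : R := \prod_(i < d) tnth x i ^+ m i.

Lemma mono_radial d (m : multinom d) (x : euclid R d) : 0 < enorm x ->
  monomial m x = enorm x ^+ mdeg m * monomial m (radial x).
Proof.
move=> x0; rewrite mdegE -prodrXr -big_split/=; apply: eq_bigr => i _.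
by rewrite tnth_mktuple -exprMn mulrC divfK// gt_eqF.
Qed.

Lemma mono_scale d (m : multinom d) (r : R) (x : euclid R d) :
  monomial m (scale r x) = r ^+ mdeg m * monomial m x.
Proof.
rewrite mdegE -prodrXr -big_split/=; apply: eq_bigr => i _.
by rewrite tnth_mktuple exprMn.
Qed.

Lemma mono_le1 d (m : multinom d) (x : euclid R d) : sqn x <= 1 -> `|monomial m x| <= 1.
Proof.
move=> x1; rewrite normr_prod; apply: prodr_ile1 => i _.
rewrite normr_ge0/= normrX exprn_ile1//.
rewrite -[_ <= _](@expr_le1 _ 2)// real_normK ?num_real//.
exact: le_trans (sqr_coord_le x i) x1.
Qed.

Lemma peval_mpolyX d (m : multinom d) (x : euclid R d) : peval (mpolyX R m) x = monomial m x.
Proof. by rewrite /peval mevalX. Qed.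

(** The value of the monomial in the direction of [x]. Being zero at the origin,
where there is no direction, it is invariant under all homotheties. *)
Definition angular d (m : multinom d) (x : euclid R d) : R :=
  (monomial m \_ (unit_sphere R d)) (radial x).

Lemma measurable_unit_sphere d : measurable (unit_sphere R d).
Proof.
rewrite (_ : unit_sphere R d = setT `&` @enorm R d @^-1` [set 1]).
  by apply: measurable_enorm.
by rewrite setTI.
Qed.

Lemma measurable_mono d (m : multinom d) : measurable_fun setT (monomial m).
Proof.
by apply: measurable_prod => i _; apply: measurable_funX; exact: measurable_tnth.
Qed.

Lemma measurable_angular d (m : multinom d) : measurable_fun setT (angular m).
Proof.
apply: (measurableT_comp (f := monomial m \_ (unit_sphere R d))); last exact: measurable_radial.
apply/measurable_restrict => //; first exact: measurable_unit_sphere.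
exact: (measurable_funTS (measurable_mono m)).
Qed.

Lemma angular_le1 d (m : multinom d) (x : euclid R d) : `|angular m x| <= 1.
Proof.
rewrite /angular patchE; case: ifPn => [|_]; last by rewrite normr0.
rewrite inE /unit_sphere/= => x1; apply: mono_le1.
by rewrite -sqr_enorm x1 expr1n.
Qed.

Lemma mono_angular d (m : multinom d) (x : euclid R d) : 0 < enorm x ->
  monomial m x = enorm x ^+ mdeg m * angular m x.
Proof.
move=> x0; rewrite mono_radial// /angular patchE mem_set//.
exact: enorm_radial.
Qed.

Lemma integrable_mono d (m : multinom d) s :
  (lebesgue_d d).-integrable (@sq_ball R d s) (EFin \o monomial m).
Proof.
rewrite (_ : monomial m = peval (mpolyX R m)); first exact: integrable_peval.
by apply/funext => x; rewrite peval_mpolyX.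
Qed.

Lemma integrable_angular d (m : multinom d) s :
  (lebesgue_d d).-integrable (@sq_ball R d s) (EFin \o angular m).
Proof.
apply: (integrable_bounded (s := s) (M := 1)) => //.
- exact: measurable_sq_ball.
- exact: measurable_angular.
- by move=> x _; exact: angular_le1.
Qed.

Lemma Rintegral_shell d (r k : R) (f : euclid R d -> R) : 0 < r < 1 ->
  measurable_fun setT f -> (forall x, f (scale r x) = k * f x) ->
  (lebesgue_d d).-integrable (@sq_ball R d 1) (EFin \o f) ->
  \int[lebesgue_d d]_(x in @sq_ball R d 1 `\` @sq_ball R d (r ^+ 2)) f x =
  (1 - r ^+ d * k) * \int[lebesgue_d d]_(x in @sq_ball R d 1) f x.
Proof.
move=> /andP[r0 r1] mf fr If.
have rB : @sq_ball R d (r ^+ 2) `<=` @sq_ball R d 1.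
  by move=> x; rewrite /sq_ball/= => /le_trans; apply; rewrite exprn_ile1// ltW.
have mB s : measurable (@sq_ball R d s) by exact: measurable_sq_ball.
rewrite mulrBl mul1r -Rintegral_scale//; apply/eqP; rewrite eq_sym subr_eq; apply/eqP.
rewrite -Rintegral_setU//.
- by rewrite setUC setDUK.
- exact: measurableD.
- by rewrite setUC setDUK.
- by rewrite disj_set2E setIC setDIK.
Qed.

(** Near the sphere a homogeneous function is close to its angular part: this
compares the two integrals on the shell outside the ball of radius [r]. *)
Lemma shell_estimate d (m : multinom d) (r : R) : 0 < r < 1 ->
  `|(1 - r ^+ (d + mdeg m)) * \int[lebesgue_d d]_(x in @sq_ball R d 1) monomial m x
    - (1 - r ^+ d) * \int[lebesgue_d d]_(x in @sq_ball R d 1) angular m x|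
  <= (1 - r ^+ mdeg m) * (1 - r ^+ d) * \int[lebesgue_d d]_(x in @sq_ball R d 1) 1.
Proof.
move=> r01; have /andP[r0 r1] := r01.
have mB s : measurable (@sq_ball R d s) by exact: measurable_sq_ball.
set S := @sq_ball R d 1 `\` @sq_ball R d (r ^+ 2).
have mS : measurable S by exact: measurableD.
have SB : S `<=` @sq_ball R d 1 by exact: subDsetl.
have IS (f : euclid R d -> R) :
    (lebesgue_d d).-integrable (@sq_ball R d 1) (EFin \o f) ->
    (lebesgue_d d).-integrable S (EFin \o f).
  exact: integrableS.
have I1 : (lebesgue_d d).-integrable (@sq_ball R d 1) (EFin \o cst (1 : R)).
  by apply: (integrable_bounded (s := 1) (M := 1)) => // x _; rewrite normr1.
have := Rintegral_shell r01 (measurable_mono m) (mono_scale m r) (integrable_mono m 1).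
rewrite -exprD => <-.
have /(_ 1) := @Rintegral_shell d r _ _ r01 (measurable_angular m) _ (integrable_angular m 1).
rewrite mulr1 => <-; last by move=> x; rewrite mul1r /angular radial_scale.
have /(_ 1) := @Rintegral_shell d r _ (cst 1) r01 (measurable_cst _) _ I1.
rewrite mulr1 -mulrA => <-; last by move=> x; rewrite mul1r.
rewrite -/S -RintegralB//; [|exact/IS/integrable_mono|exact/IS/integrable_angular].
have IB : (lebesgue_d d).-integrable S (EFin \o (fun x => monomial m x - angular m x)).
  exact: (integrableB mS (IS _ (integrable_mono m 1)) (IS _ (integrable_angular m 1))).
apply: le_trans (le_normr_Rintegral mS IB) _.
rewrite -RintegralZl//; last exact: IS.
apply: le_Rintegral => //.
- exact: integrable_norm.
- exact: (integrableZl mS (1 - r ^+ mdeg m) (IS _ I1)).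
move=> x [x1 /negP xr]; move: x1 xr; rewrite /sq_ball/= -sqr_enorm -ltNge.
have x0 := enorm_ge0 x.
rewrite expr_le1// ltr_sqr ?nnegrE ?(ltW r0)// => x1 rx.
rewrite mono_angular ?(lt_trans r0)// -{2}[angular m x]mul1r -mulrBl normrM.
rewrite ler_pM// ?angular_le1// distrC ger0_norm ?subr_ge0 ?exprn_ile1//.
by rewrite lerD2l lerN2 lerXn2r ?nnegrE// ltW.
Qed.

End polar_coordinates.

(** * The integrals over the ball and the sphere form a Green pair *)

Section ball_and_sphere.
Context {R : realType}.

(** Dividing the shell estimate by [1 - r] and letting [r] tend to [1]. *)
Lemma shell_limit (d k : nat) (a b V : R) :
  (forall r, 0 < r < 1 -> `|(1 - r ^+ (d + k)) * a - (1 - r ^+ d) * b|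
    <= (1 - r ^+ k) * (1 - r ^+ d) * V) ->
  (d + k)%:R * a = d%:R * b.
Proof.
move=> h; pose S n : {poly R} := \sum_(i < n) 'X^i.
have SE n r : 1 - r ^+ n = (1 - r) * (S n).[r].
  rewrite -opprB subrX1 -mulNr opprB /S horner_sum; congr (_ * _).
  by apply: eq_bigr => i _; rewrite hornerXn.
have S1 n : (S n).[1] = n%:R.
  rewrite /S horner_sum (eq_bigr (fun=> 1)) => [|i _]; last by rewrite hornerXn expr1n.
  by rewrite sumr_const card_ord.
pose q := S (d + k)%N * a%:P - S d * b%:P.
pose g := (1 - 'X^k) * S d * V%:P.
have qg r : 0 < r < 1 -> `|q.[r]| <= g.[r].
  move=> r01; have r1 : 0 < 1 - r by case/andP: r01; rewrite subr_gt0.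
  have := h r r01; rewrite !(SE d) (SE (d + k)%N) -!mulrA -mulrBr normrM gtr0_norm//.
  have -> : g.[r] = (1 - r ^+ k) * ((S d).[r] * V) by rewrite /g !hornerE/= -mulrA.
  have -> : q.[r] = (S (d + k)%N).[r] * a - (S d).[r] * b by rewrite /q !hornerE.
  by rewrite [X in _ <= X -> _]mulrCA ler_pM2l.
suff /eqP : q.[1] = 0 by rewrite /q !hornerE !S1 subr_eq0 => /eqP.
apply/eqP; apply/negPn/negP => q1.
have cqg : (fun r => `|q.[r]| - g.[r]) @ (1 : R)^'- --> `|q.[1]| - g.[1].
  apply: cvg_at_left_filter; apply: cvgB; last exact: continuous_horner.
  by apply: cvg_norm; exact: continuous_horner.
have g1 : g.[1] = 0 by rewrite /g !hornerE expr1n subrr !mul0r.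
rewrite g1 subr0 in cqg.
have : \forall r \near (1 : R)^'-, 0 < `|q.[r]| - g.[r].
  by apply: (cvgr_gt _ cqg); rewrite normr_gt0.
have : \forall r \near (1 : R)^'-, 0 < r < 1.
  near=> r; apply/andP; split; last by near: r; exact: nbhs_left_lt.
  by near: r; exact: nbhs_left_gt.
move=> H1 H2; near (1 : R)^'- => r.
have /qg r01 : 0 < r < 1 by near: r.
have : 0 < `|q.[r]| - g.[r] by near: r.
by rewrite subr_gt0 ltNge r01.
Unshelve. all: by end_near.
Qed.

(** Integration in polar coordinates: the integrals on thin shells below the sphere
determine both sides. *)
Lemma polar_mono d (m : multinom d) :
  d%:R * \int[lebesgue_d d]_(x in @sq_ball R d 1) angular m x =
  (d + mdeg m)%:R * \int[lebesgue_d d]_(x in @sq_ball R d 1) monomial m x.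
Proof. by apply/esym/shell_limit => r r01; exact: shell_estimate. Qed.

Lemma ge0_integral_surface d (f : euclid R d -> \bar R) :
  measurable_fun setT f -> (forall x, 0 <= f x)%E ->
  (\int[surface_measure R d]_x f x =
   d%:R%:E * \int[lebesgue_d d]_(x in unit_ball R d) f (radial x))%E.
Proof.
move=> mf f0; rewrite ge0_integral_mscale//=; congr (_ * _)%E.
rewrite ge0_integral_pushforward//; last exact: measurable_radial.
rewrite preimage_setT.
have mfr : measurable_fun setT (f \o @radial R d).
  by apply: measurableT_comp => //; exact: measurable_radial.
have mB := @measurable_unit_ball R d.
rewrite (ge0_negligible_integral (measurableC mB) measurableT mfr (fun x _ => f0 _)); last first.
  by rewrite -[LHS]/(lebesgue_d d (~` unit_ball R d `&` unit_ball R d)) setICl measure0.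
rewrite setTD setCK; apply: eq_measure_integral => A mA AB.
by rewrite -[LHS]/(lebesgue_d d (A `&` unit_ball R d)) setIidl.
Qed.

Lemma surface_measure_sphere_lty d : (surface_measure R d (unit_sphere R d) < +oo)%E.
Proof.
rewrite /surface_measure /= /mscale /= /cone_measure /pushforward /mrestr.
rewrite lte_mul_pinfty//; apply: le_lt_trans (volume_sq_ball_lty d 1).
have mB := @measurable_unit_ball R d.
rewrite -unit_ballE; apply: le_measure; rewrite ?inE//.
apply: measurableI => //; rewrite -[X in measurable X]setTI.
by apply: measurable_radial => //; exact: measurable_unit_sphere.
Qed.

Lemma integrable_surface d (p : mpoly d R) :
  (surface_measure R d).-integrable (unit_sphere R d) (EFin \o peval p).
Proof.
apply: measurable_bounded_integrable.
- exact: measurable_unit_sphere.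
- exact: surface_measure_sphere_lty.
- exact: (measurable_funTS (measurable_peval p)).
- exists (\sum_(m <- msupp p) `|mcoeff m p| * 1 ^+ mdeg m); split; first exact: num_real.
  move=> K pK x x1; apply: le_trans (ltW pK); apply: peval_bounded => // i.
  rewrite -[_ <= _](@expr_le1 _ 2)// real_normK ?num_real//.
  by apply: le_trans (sqr_coord_le x i) _; rewrite -sqr_enorm x1 expr1n.
Qed.

Lemma Rintegral_surface_mono d (m : multinom d) :
  \int[surface_measure R d]_(x in unit_sphere R d) monomial m x =
  d%:R * \int[lebesgue_d d]_(x in unit_ball R d) angular m x.
Proof.
rewrite /Rintegral -integral_patch.
pose g := EFin \o (monomial m \_ (unit_sphere R d)).
have mg : measurable_fun setT g.
  apply/measurable_EFinP/measurable_restrict => //; first exact: measurable_unit_sphere.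
  exact: (measurable_funTS (measurable_mono m)).
have Ia : (lebesgue_d d).-integrable (unit_ball R d) (EFin \o angular m).
  by rewrite unit_ballE; exact: integrable_angular.
have mB := @measurable_unit_ball R d.
rewrite [X in fine X = _]integralE.
rewrite (ge0_integral_surface (measurable_funepos mg))//.
rewrite (ge0_integral_surface (measurable_funeneg mg))//.
have gr : EFin \o angular m = g \o @radial R d by [].
rewrite -[fun x => (_^\+)%E _]/(g^\+ \o @radial R d)%E.
rewrite -[fun x => (_^\-)%E _]/(g^\- \o @radial R d)%E.
rewrite -funepos_comp -funeneg_comp -gr -muleBr//; last first.
  exact/fin_num_adde_defr/(integrable_pos_fin_num mB Ia).
by rewrite -integralE fineM//; exact: integrable_fin_num.
Qed.

Context {d : nat}.
Implicit Types p q : mpoly d R.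

Definition ball_int p : R := \int[lebesgue_d d]_(x in unit_ball R d) peval p x.

Definition sphere_int p : R :=
  \int[surface_measure R d]_(x in unit_sphere R d) peval p x.

Lemma integrable_ball p : (lebesgue_d d).-integrable (unit_ball R d) (EFin \o peval p).
Proof. by rewrite unit_ballE; exact: integrable_peval. Qed.

Lemma pevalP (a : R) p q (x : euclid R d) :
  peval (a *: p + q) x = a * peval p x + peval q x.
Proof. by rewrite /peval mevalD mevalZ. Qed.

Fact ball_int_is_linear : scalar ball_int.
Proof.
move=> a p q; rewrite /ball_int; have mB := @measurable_unit_ball R d.
under eq_Rintegral do rewrite pevalP.
rewrite RintegralD//; last 2 first.
- exact: (integrableZl mB a (integrable_ball p)).
- exact: integrable_ball.
by rewrite RintegralZl//; exact: integrable_ball.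
Qed.

Fact sphere_int_is_linear : scalar sphere_int.
Proof.
move=> a p q; rewrite /sphere_int; have mS := @measurable_unit_sphere R d.
under eq_Rintegral do rewrite pevalP.
rewrite RintegralD//; last 2 first.
- exact: (integrableZl mS a (integrable_surface p)).
- exact: integrable_surface.
by rewrite RintegralZl//; exact: integrable_surface.
Qed.

HB.instance Definition _ :=
  GRing.isLinear.Build R (mpoly d R) R *%R ball_int ball_int_is_linear.

HB.instance Definition _ :=
  GRing.isLinear.Build R (mpoly d R) R *%R sphere_int sphere_int_is_linear.

Local Notation w := (one_sub_sqnorm R d).
Local Notation X i := (mpolyX R (mnm1 i) : mpoly d R).
Local Notation D := mderiv.

Lemma pevalM p q x : peval (p * q) x = peval p x * peval q x.
Proof. by rewrite /peval mevalM. Qed.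

Lemma peval_w (x : euclid R d) : peval w x = 1 - enorm x ^+ 2.
Proof. by rewrite sqr_enorm -peval_sqnorm /peval one_sub_sqnormE mevalB meval1. Qed.

Lemma pevalXn p k (x : euclid R d) : peval (p ^+ k) x = peval p x ^+ k.
Proof. by rewrite /peval rmorphXn. Qed.

Lemma sphere_int_w p : sphere_int (w * p) = 0.
Proof.
rewrite /sphere_int (@eq_Rintegral _ _ _ _ _ (fun=> 0)); last first.
  move=> x; rewrite inE /unit_sphere/= => x1.
  by rewrite pevalM peval_w x1 expr1n subrr mul0r.
by rewrite Rintegral_cst ?mul0r//; exact: measurable_unit_sphere.
Qed.

Lemma ball_int_gt0 : 0 < ball_int 1.
Proof.
rewrite /ball_int (@eq_Rintegral _ _ _ _ _ (fun=> 1)) => [|x _]; last by rewrite /peval meval1.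
rewrite Rintegral_cst ?mul1r; last exact: measurable_unit_ball.
rewrite fine_gt0// volume_ball_gt0/=.
by rewrite unit_ballE volume_sq_ball_lty.
Qed.

(** Unlike in [sphere_homog], polar coordinates precede here the divergence
theorem, in whose proof they are used. *)
Lemma sphere_int_homog k p : p \is ishomog1 k mdeg ->
  sphere_int p = (d + k)%:R * ball_int p.
Proof.
move=> /dhomogP hp; rewrite (mpolyE p) !raddf_sum mulr_sumr.
apply: eq_big_seq => m mp; rewrite /= !linearZ/= mulrCA; congr (_ * _).
rewrite -(hp m mp : mdeg m = k) /sphere_int /ball_int.
under eq_Rintegral do rewrite peval_mpolyX.
under [in RHS]eq_Rintegral do rewrite peval_mpolyX.
by rewrite Rintegral_surface_mono unit_ballE polar_mono.
Qed.

Lemma peval_deriv_w i (m : multinom d) x :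
  peval (D i (w * mpolyX R m)) x = div_term m i 1 1 x.
Proof.
rewrite mderivM mderiv_w mderivX /div_term mul1r.
have -> : \prod_j tnth x j ^+ (m j - (i == j)) = peval (mpolyX R (mnm_sub m (mnm1 i))) x.
  by rewrite peval_mpolyX; apply: eq_bigr => j _; rewrite mnmBE mnm1E.
have -> : \prod_j tnth x j ^+ (m j + (i == j)) = peval (X i * mpolyX R m) x.
  rewrite -mpolyXD peval_mpolyX; apply: eq_bigr => j _.
  by rewrite mnmDE mnm1E addnC.
rewrite -sqr_enorm -peval_w -scaler_nat /peval !(mevalD, mevalM, mevalN, mevalZ).
by ring.
Qed.

Lemma ball_int_deriv_w i p : ball_int (D i (w * p)) = 0.
Proof.
rewrite (mpolyE p) mulr_sumr (raddf_sum (mderiv i)) (raddf_sum ball_int) big1// => m _.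
rewrite /= -scalerAr mderivZ linearZ/= (_ : ball_int _ = 0) ?mulr0//.
rewrite /ball_int unit_ballE /Rintegral -[RHS]/(fine 0%E); congr fine.
rewrite -[RHS](integral_div_term m i 1 1) integral_patch.
by apply: eq_integral => x _; rewrite peval_deriv_w.
Qed.

(** In [ball_int_deriv_w], the polynomials [D i p] and [sqnorm * D i p] are equal
on the sphere, so that their integrals over the ball are proportional; this
eliminates the second one. *)
Lemma divergence_mono i (m : multinom d) : (0 < d)%N ->
  ball_int (D i (mpolyX R m)) = sphere_int (X i * mpolyX R m).
Proof.
move=> d0; set p := mpolyX R m.
have hp : p \is ishomog1 (mdeg m) mdeg by rewrite dhomogX.
have hX : X i \is ishomog1 1 mdeg by rewrite dhomogX -[Y in Y == _]/(mdeg _) mdeg1.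
have hS : (sqnorm : mpoly d R) \is ishomog1 2 mdeg.
  apply: rpred_sum => j _.
  by rewrite mpolyXn dhomogX -[Y in Y == _]/(mdeg _) mdegMn mdeg1.
have SXp := sphere_int_homog (dhomogM hX hp).
have B0 := ball_int_deriv_w i p.
have Bw : ball_int (D i (w * p)) =
    ball_int (D i p) - ball_int (sqnorm * D i p) - 2 * ball_int (X i * p).
  rewrite mderivM mderiv_w one_sub_sqnormE mulrBl mul1r mulNr.
  by rewrite (mulrnAl (X i)) addrC !raddfB/= raddfMn/= mulr_natl.
have [mi0|mi0] := eqVneq (m i) 0%N.
  have Dp0 : D i p = 0 by rewrite /p mderivX mi0 scale0r.
  move: B0; rewrite Bw SXp Dp0 mulr0 raddf0 subr0 sub0r => /eqP.
  by rewrite oppr_eq0 mulf_eq0 pnatr_eq0/= => /eqP ->; rewrite mulr0.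
have hD := homog_mderiv i hp.
have m0 : (0 < mdeg m)%N.
  by rewrite mdegE (bigD1 i)//= addn_gt0 lt0n mi0.
have SD := sphere_int_homog hD; have SSD := sphere_int_homog (dhomogM hS hD).
have SE : sphere_int (sqnorm * D i p) = sphere_int (D i p).
  have -> : (sqnorm : mpoly d R) = 1 - w by rewrite one_sub_sqnormE opprB addrC subrK.
  by rewrite mulrBl mul1r raddfB/= sphere_int_w subr0.
rewrite SE SD in SSD; rewrite Bw in B0; rewrite SXp.
have e1 : (d + (mdeg m).-1)%:R = (d + (1 + mdeg m))%:R - 2 :> R.
  by apply/eqP; rewrite eq_sym subr_eq -natrD eqr_nat; apply/eqP; lia.
have e2 : (d + (2 + (mdeg m).-1))%:R = (d + (1 + mdeg m))%:R :> R.
  by congr (_%:R); lia.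
rewrite e1 e2 in SSD; move: SSD B0.
move: (ball_int (D i p)) (ball_int (sqnorm * D i p)) (ball_int (X i * p)) => x y z.
move: (d + (1 + mdeg m))%:R => c h1 h2.
have h3 : 2 * z = x - y by apply/eqP; rewrite eq_sym -subr_eq0; apply/eqP.
apply: (mulfI (_ : 2 != 0)); first by rewrite pnatr_eq0.
by rewrite mulrCA h3 mulrBr -h1; ring.
Qed.

Lemma divergence_poly i p : (0 < d)%N -> ball_int (D i p) = sphere_int (X i * p).
Proof.
move=> d0; rewrite (mpolyE p) mulr_sumr (raddf_sum (mderiv i)) (raddf_sum ball_int).
rewrite (raddf_sum sphere_int); apply: eq_bigr => m _.
by rewrite /= mderivZ -scalerAr !linearZ/= divergence_mono.
Qed.

Lemma green_pair_int : (0 < d)%N -> green_pair ball_int sphere_int.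
Proof.
move=> d0; split.
- move=> k p; apply: Rintegral_ge0 => x; rewrite unit_ballE /sq_ball/= => x1.
  rewrite !pevalM pevalXn peval_w sqr_enorm mulr_ge0//; last exact: sqr_ge0.
  by rewrite exprn_ge0// subr_ge0.
- by move=> p; apply: Rintegral_ge0 => x _; rewrite pevalM; exact: sqr_ge0.
- exact: ball_int_gt0.
- by move=> i p; exact: divergence_poly.
- exact: sphere_int_w.
Qed.

Lemma sphere_area_gt0 : (0 < d)%N -> 0 < sphere_area R d.
Proof.
move=> d0; have -> : sphere_area R d = sphere_int 1.
  by apply: eq_Rintegral => x _; rewrite /peval meval1.
rewrite (sphere_int_homog (dhomog1 _ _)) addn0 mulr_gt0 ?ltr0n//.
exact: ball_int_gt0.
Qed.

Lemma sobolev_ipE (lambda : R) : @sobolev_ip R d lambda =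
  sobolev_form (IB := ball_int) (IS := sphere_int)
    (lambda / sphere_area R d) (sphere_area R d)^-1.
Proof.
apply/funext => f; apply/funext => g; rewrite /sobolev_ip /sobolev_form.
by congr (_ * _ + _ * _); apply: eq_Rintegral => x _; rewrite pevalM.
Qed.

Lemma W2_ipE : @W2_ip R d = weighted_ip (IB := ball_int) 2.
Proof.
apply/funext => f; apply/funext => g; rewrite /W2_ip /weighted_ip.
apply: eq_Rintegral => x _; rewrite pevalM pevalM pevalXn peval_w.
by rewrite mulrC mulrA.
Qed.

End ball_and_sphere.

Theorem theorem4p1 (R : realType) (d : nat) (hd : (1 <= d)%N)
    (lambda : R) (hlambda : 0 < lambda) (n : nat) :
  [/\ lspan (VWm2 R d n) `<=` orthopoly (sobolev_ip lambda) n,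
      (exists (m : nat) (b : 'I_m -> mpoly d R),
        [/\ forall i, VWm2 R d n (b i),
            orthonormal_family (sobolev_ip lambda) b
          & lspan (range b) = orthopoly (sobolev_ip lambda) n])
    & orthogonal_direct_sum3 (sobolev_ip lambda) (lspan (VWm2 R d n))
        (lspan (piece0 R d n)) (lspan (piece1 R d n)) (lspan (piece2 R d n))].
Proof.
have area0 := @sphere_area_gt0 R d hd.
apply: (VWm2_structure (@green_pair_int R d hd) hd _ _ (sobolev_ipE _) W2_ipE).
  by rewrite divr_gt0.
by rewrite invr_gt0.
Qed.
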